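(* Let $M=\{\mu_{i,j}\}$ be a $K\times K$ preference matrix whose Condorcet winner is arm $1$, and let $f(K)\ge 0$. For any sufficiently small $\delta>0$, the regret of the RMED1 algorithm is bounded as $$\mathbb{E}[R(T)]\le\sum_{i\in[K]\setminus\{1\}}\frac{\bigl((1+\delta)\log T+f(K)\bigr)\Delta_{1,i}}{2\,d(\mu_{i,1},1/2)}+O(K^2)+O\!\left(\frac{K}{\delta^2}\right)+O\!\left(K e^{AK-f(K)}\right),$$ where $A=A(\{\mu_{i,j}\}_{i,j\in[K]})$ is a constant as a function of $T$. Therefore, by letting $\delta=\log^{-1/3}T$ and choosing $f(K)=cK^{1+\epsilon}$ for arbitrary $c,\epsilon>0$, $$\mathbb{E}[R(T)]\le\sum_{i\in[K]\setminus\{1\}}\frac{\Delta_{1,i}\log T}{2\,d(\mu_{i,1},1/2)}+O(K^{2+\epsilon})+O(K\log^{2/3}T).$$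
   Context: $K$-armed dueling bandit: $[K]=\{1,\dots,K\}$ is the set of arms. A preference matrix is $M=\{\mu_{i,j}\}\in[0,1]^{K\times K}$ with $\mu_{i,j}=1-\mu_{j,i}$, $\mu_{i,i}=1/2$. At each round $t=1,\dots,T$ the algorithm selects (draws) a pair $(l(t),m(t))\in[K]^2$ and receives feedback distributed as $\mathrm{Bernoulli}(\mu_{l(t),m(t)})$, independent of the past given the pair (value $1$ means $l(t)$ is preferred to $m(t)$). Arm $1$ is the Condorcet winner: $\mu_{1,j}>1/2$ for all $j\ne 1$. $\Delta_{i,j}=\mu_{i,j}-1/2$; the regret of a round in which $(i,j)$ is selected is $r(t)=(\Delta_{1,i}+\Delta_{1,j})/2$, and $R(T)=\sum_{t=1}^T r(t)$. $d(p,q)=p\log\frac pq+(1-p)\log\frac{1-p}{1-q}$ (with $0\log0=0$). Statistics: for $i\ne j$, $N_{i,j}(t)$ is the number of rounds $t'\le t-1$ in which the unordered pair $\{i,j\}$ was compared; $\hat\mu_{i,j}(t)$ is the number of those rounds in which $i$ was preferred to $j$ divided by $N_{i,j}(t)$ (with $0/0=1/2$); $\hat\mu_{i,i}(t)=1/2$. The opponents of $i$ are $\hat{\mathcal{O}}_i(t)=\{j\in[K]\setminus\{i\}:\hat\mu_{i,j}(t)\le 1/2\}$. The empirical divergence is $I_i(t)=\sum_{j\in\hat{\mathcal{O}}_i(t)}N_{i,j}(t)\,d(\hat\mu_{i,j}(t),1/2)$; $i^*(t)=\arg\min_{i\in[K]}I_i(t)$ (ties broken arbitrarily) and $I^*(t)=I_{i^*(t)}(t)$.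 $\mathcal{J}_i(t)$ is the event $\{I_i(t)-I^*(t)\le\log t+f(K)\}$, where $f(K)\ge0$ is an input, independent of $t$. RMED1 algorithm. Initial phase: draw each unordered pair of distinct arms once; it ends at round $T_{\mathrm{init}}=K(K-1)/2$. Set $L_C=L_R=[K]$, $L_N=\emptyset$. Then, from round $t=T_{\mathrm{init}}+1$, while $t\le T$, repeat the following loop: for each $l(t)\in L_C$ in an arbitrarily fixed order: (1) choose $m(t)$: if $i^*(t)\in\hat{\mathcal{O}}_{l(t)}(t)$ or $\hat{\mathcal{O}}_{l(t)}(t)=\emptyset$, then $m(t)=i^*(t)$; otherwise $m(t)=\arg\min_{j\ne l(t)}\hat\mu_{l(t),j}(t)$; (2) draw the pair $(l(t),m(t))$; (3) $L_R\leftarrow L_R\setminus\{l(t)\}$; (4) add to $L_N$ (without duplicates) every $j\notin L_R$ for which $\mathcal{J}_j(t)$ holds; (5) $t\leftarrow t+1$. When all of $L_C$ has been processed, set $L_C\leftarrow L_N$, $L_R\leftarrow L_N$, $L_N\leftarrow\emptyset$ and start the next loop. Conventions: ''for any sufficiently small $\delta$'' means for all $\delta\in(0,\delta_0)$ with some $\delta_0>0$ not depending on $T$. The implied constants in the $O(\cdot)$ terms do not depend on $T$ or $\delta$ (they may depend on the problem instance, i.e. the preference matrix, and on the choice of $f$). $O(\cdot)$ is understood for large $T$. *)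

(* Defs.v *)
From HB Require Import structures.
From mathcomp Require Import all_boot all_order all_algebra.
From mathcomp Require Import all_classical all_reals all_analysis.

Set Implicit Arguments.
Unset Strict Implicit.
Unset Printing Implicit Defensive.
Import Order.TTheory GRing.Theory Num.Theory.
Import numFieldNormedType.Exports.

Local Open Scope classical_set_scope.
Local Open Scope ring_scope.

(** * K-armed dueling bandits and the RMED1 algorithm

    Arms are numbered from 0, so "arm 1" is the ordinal of value 0. *)

Definition arm1 (K : nat) (hK : (0 < K)%N) : 'I_K := Ordinal hK.

Definition preference_matrix (R : realType) (K : nat) (mu : 'M[R]_K) : Prop :=
  [/\ forall i j, 0 <= mu i j <= 1,
      forall i j, mu i j = 1 - mu j i &
      forall i, mu i i = 1 / 2].

Definition condorcet_winner (R : realType) (K : nat) (mu : 'M[R]_K)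
    (w : 'I_K) : Prop :=
  forall j, j != w -> mu w j > 1 / 2.

Definition gap (R : realType) (K : nat) (mu : 'M[R]_K) (i j : 'I_K) : R :=
  mu i j - 1 / 2.

(** [0 log 0 = 0] holds automatically because [0 * _ = 0]. *)
Definition kl (R : realType) (p q : R) : R :=
  p * ln (p / q) + (1 - p) * ln ((1 - p) / (1 - q)).

(** The record [(l, m, x)] of a round: the pair drawn is [(l, m)], and
    [x = true] iff [l] was preferred to [m]. *)
Definition round (K : nat) : Type := ('I_K * 'I_K * bool)%type.

(** ** Statistics

    A trajectory [tr : nat -> round K] gives the record [tr t] of round
    [t >= 1]; [tr 0] is never used.  Statistics at time [t] only depend on the
    rounds [1, ..., t - 1]. *)

Section Statistics.
Variables (R : realType) (K : nat) (tr : nat -> round K) (t : nat).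

Definition compared (r : round K) (i j : 'I_K) : bool :=
  (r.1 == (i, j)) || (r.1 == (j, i)).

Definition preferred (r : round K) (i j : 'I_K) : bool :=
  (r == (i, j, true)) || (r == (j, i, false)).

Definition ncomp (i j : 'I_K) : nat :=
  (\sum_(1 <= s < t) compared (tr s) i j)%N.

Definition nwins (i j : 'I_K) : nat :=
  (\sum_(1 <= s < t) preferred (tr s) i j)%N.

Definition muhat (i j : 'I_K) : R :=
  if (i == j) || (ncomp i j == 0%N) then 1 / 2
  else (nwins i j)%:R / (ncomp i j)%:R.

Definition opponents (i : 'I_K) : {set 'I_K} :=
  [set j | (j != i) && (muhat i j <= 1 / 2)]%SET.

Definition empdiv (i : 'I_K) : R :=
  \sum_(j in opponents i) (ncomp i j)%:R * kl (muhat i j) (1 / 2).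

Definition is_istar (istar : 'I_K) : Prop :=
  forall i, empdiv istar <= empdiv i.

(** The event J_j(t); [istar] is any minimizer of [empdiv], and [fK] stands for
    the value f(K). *)
Definition eventJ (fK : R) (istar j : 'I_K) : bool :=
  empdiv j - empdiv istar <= ln t%:R + fK.

Definition valid_opponent (istar l m : 'I_K) : Prop :=
  if (istar \in opponents l) || (opponents l == finset.set0) then m = istar
  else m != l /\ forall j, j != l -> muhat l m <= muhat l j.

End Statistics.

(** ** The algorithm *)

(** [todo] lists the arms of L_C not yet processed in the current loop, in
    order of processing. *)
Record loop_state (K : nat) := LoopState {
  todo : seq 'I_K;
  LR : {set 'I_K};
  LN : {set 'I_K} }.

(** State at the beginning of a loop with L_C = L_R = [L], L_N empty; the order
    in which [L] is processed is arbitrary. *)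
Definition loop_start (K : nat) (L : {set 'I_K}) (S : loop_state K) : Prop :=
  [/\ perm_eq (todo S) (enum L), LR S = L & LN S = finset.set0].

(** Round [t] of the main phase, going from state [S] to state [S'].  The arm
    [istar] is i^*(t), with ties broken arbitrarily. *)
Definition main_round (R : realType) (K : nat) (fK : R) (tr : nat -> round K)
    (t : nat) (S S' : loop_state K) : Prop :=
  let l := (tr t).1.1 in
  let m := (tr t).1.2 in
  exists (istar : 'I_K) (rest : seq 'I_K),
    [/\ is_istar R tr t istar,
        todo S = l :: rest,
        valid_opponent R tr t istar l m &
        let LR' := (LR S :\ l)%SET in
        let LN' := (LN S :|:
                    [set j | (j \notin LR') && eventJ tr t fK istar j])%SET in
        if rest is [::] then loop_start LN' S'
        else S' = LoopState rest LR' LN'].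

Definition Tinit (K : nat) : nat := (K * K.-1) %/ 2.

(** The pairs drawn in rounds [1, ..., T] are compatible with RMED1 and the
    feedback received.  The list [E] enumerates the unordered pairs of distinct
    arms, each once; the initial phase is truncated if [T < Tinit K]. *)
Definition rmed1_trajectory (R : realType) (K : nat) (fK : R) (T : nat)
    (tr : nat -> round K) : Prop :=
  (exists E : seq ('I_K * 'I_K),
     perm_eq [seq [set p.1; p.2]%SET | p <- E]
             (enum [set B : {set 'I_K} | #|B| == 2%N]%SET) /\
     [seq (tr s).1 | s <- iota 1 (minn T (Tinit K))] = take T E) /\
  (exists S : nat -> loop_state K,
     loop_start [set: 'I_K]%SET (S (Tinit K).+1) /\
     forall t, (Tinit K < t <= T)%N -> main_round fK tr t (S t) (S t.+1)).

(** ** Probability model *)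

Section Process.
Variables (R : realType) (K : nat) (d : measure_display)
  (Omega : measurableType d) (P : probability Omega R).
Variables (T : nat) (Z : nat -> Omega -> round K).

Definition discrete_process : Prop :=
  forall t, (1 <= t <= T)%N -> forall r : round K,
    measurable [set w | Z t w = r].

(** The conditional probability of preferring [i] to [j] in round [t], given
    any past [h] and that [(i, j)] is drawn in round [t], is [mu i j] (in
    product form, so that conditioning events may be null). *)
Definition bernoulli_feedback (mu : 'M[R]_K) : Prop :=
  forall t, (1 <= t <= T)%N -> forall (h : nat -> round K) (i j : 'I_K),
    let past := [set w | forall s, (1 <= s < t)%N -> Z s w = h s] in
    (P (past `&` [set w | Z t w = (i, j, true)]) =
     (mu i j)%:E * P (past `&` [set w | (Z t w).1 = (i, j)]))%E.

Definition rmed1_run (mu : 'M[R]_K) (fK : R) : Prop :=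
  [/\ discrete_process, bernoulli_feedback mu &
      forall w, rmed1_trajectory fK T (fun t => Z t w)].

End Process.

Definition regret (R : realType) (K : nat) (mu : 'M[R]_K) (w : 'I_K)
    (T : nat) (tr : nat -> round K) : R :=
  \sum_(1 <= t < T.+1) (gap mu w (tr t).1.1 + gap mu w (tr t).1.2) / 2.

(** The expected regret at horizon [T] of RMED1 with input [f(K) = fK] is at
    most [b], whatever the tie-breaking and the processing orders. *)
Definition rmed1_regret_le (R : realType) (K : nat) (mu : 'M[R]_K)
    (w : 'I_K) (fK : R) (T : nat) (b : R) : Prop :=
  forall (d : measure_display) (Omega : measurableType d)
    (P : probability Omega R) (Z : nat -> Omega -> round K),
    rmed1_run P T Z mu fK ->
    ('E_P[fun omega => regret mu w T (fun t => Z t omega)] <= b%:E)%E.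

(* Main.v *)
Require Import Defs.
From HB Require Import structures.
From mathcomp Require Import all_boot all_order all_algebra.
From mathcomp Require Import all_classical all_reals all_analysis measurable_realfun.
From mathcomp Require Import ring lra zify.
Import Order.TTheory GRing.Theory Num.Theory.
Import numFieldNormedType.Exports.
Local Open Scope ring_scope.

(** Write [w] for the Condorcet winner.  While [w] has no opponent, it is the
    only minimizer of the empirical divergence, so every drawn pair contains
    [w], and arm [i] is recommended only as long as
    [N_{w,i} * d(hat mu_{w,i}, 1/2) <= log T + f]; this gives the leading term,
    up to the draws of [{w, i}] at which [hat mu_{w,i}] is below
    [mu_{w,i} - c * delta].

    A round in which [w] has an opponent is followed, within two loops, by a draw
    of a pair [{w, s}] with [hat mu_{w,s} <= 1/2], unless the empirical divergence
    of [w] exceeds [log t] at that round [t].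

    Both kinds of exceptional rounds are bounded in expectation by potential
    functions of the numbers [k] of wins and [l] of losses of [w] against [s].
    Low draws: the potential [exp (- lam * (k - y * (k + l)))] decreases in mean
    by a constant factor at each draw.  Large divergence: the product over [s] of
    [1 + k! l! / (k + l + 1)! * a ^ k * b ^ l] (a Laplace mixture of likelihood
    ratios) is a supermartingale which dominates [exp ((1 + e) * I_w)], so round
    [t] is exceptional with probability [O(t ^ -(1 + e))]. *)

Set Implicit Arguments.
Unset Strict Implicit.
Unset Printing Implicit Defensive.

(** * Divergence from 1/2 *)

Section Kl.
Context {R : realType}.
Implicit Types x q m : R.

Lemma mulr_ln_div x q : 0 <= x -> 0 < q -> x * ln (x / q) = x * ln x - x * ln q.
Proof.
rewrite le_eqVlt => /predU1P[<-|x0] q0; first by rewrite !mul0r subr0.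
by rewrite ln_div ?posrE// mulrBr.
Qed.

Lemma klE x q : 0 <= x <= 1 -> 0 < q < 1 ->
  kl x q = x * ln x - x * ln q + ((1 - x) * ln (1 - x) - (1 - x) * ln (1 - q)).
Proof.
move=> /andP[x0 x1] /andP[q0 q1].
by rewrite /kl !mulr_ln_div// ?subr_ge0 ?subr_gt0.
Qed.

(** The tangent bound [ln u <= u - 1] at [u = q / x]. Adding the instance at [1 - x] and [1 - q]
    makes the left-hand sides cancel, which gives Gibbs' inequality. *)
Lemma mulr_ln_div_ge x q : 0 <= x -> 0 < q -> x - q <= x * ln (x / q).
Proof.
rewrite le_eqVlt => /predU1P[<-|x0] q0; first by rewrite mul0r sub0r oppr_le0 ltW.
have := le_ln1Dx (x := q / x - 1).
have -> : 1 + (q / x - 1) = q / x by ring.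
have qx : 0 < q / x by rewrite divr_gt0.
have /[swap]/[apply] : -1 < q / x - 1 by lra.
rewrite -[x / q]invf_div lnV ?posrE// -(ler_pM2l x0) mulrBr mulr1 mulrN.
have -> : x * (q / x) = q by field; rewrite gt_eqF.
lra.
Qed.

Lemma mulr_ln_div_gt x q : 0 <= x -> 0 < q -> x != q -> x - q < x * ln (x / q).
Proof.
rewrite le_eqVlt => /predU1P[<-|x0] q0 neq; first by rewrite mul0r sub0r oppr_lt0.
have qx : 0 < q / x by rewrite divr_gt0.
have ln_neq0 : ln (q / x) != 0.
  rewrite ln_eq0//; apply: contraNneq neq => /(congr1 (fun y => y * x)) /=.
  by rewrite divfK ?lt0r_neq0// mul1r => ->.
have := expR_gt1Dx ln_neq0; rewrite lnK ?posrE//.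
rewrite -[x / q]invf_div lnV ?posrE// -(ltr_pM2l x0) mulrDr mulr1 mulrN.
have -> : x * (q / x) = q by field; rewrite gt_eqF.
lra.
Qed.

Lemma kl_ge0 x q : 0 <= x <= 1 -> 0 < q < 1 -> 0 <= kl x q.
Proof.
move=> /andP[x0 x1] /andP[q0 q1].
have h1 := mulr_ln_div_ge x0 q0.
have := @mulr_ln_div_ge (1 - x) (1 - q); rewrite /kl; lra.
Qed.

Lemma kl_gt0 x q : 0 <= x <= 1 -> 0 < q < 1 -> x != q -> 0 < kl x q.
Proof.
move=> /andP[x0 x1] /andP[q0 q1] neq.
have h1 := mulr_ln_div_gt x0 q0 neq.
have := @mulr_ln_div_ge (1 - x) (1 - q); rewrite /kl; lra.
Qed.

Lemma half_in01 : 0 < (1 / 2 : R) < 1. Proof. lra. Qed.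

(* The gap between the two sides is [kl x m], by Gibbs' inequality. *)
Lemma kl_half_tangent x m : 0 <= x <= 1 -> 0 < m < 1 ->
  kl m (1 / 2) + (x - m) * ln (m / (1 - m)) <= kl x (1 / 2).
Proof.
move=> x01 m01; have m01' : 0 <= m <= 1 by lra.
have := kl_ge0 x01 m01; rewrite !klE// ?half_in01// ln_div ?posrE; try lra.
have -> : 1 - 1 / 2 = 1 / 2 :> R by lra.
lra.
Qed.

Lemma kl_half_le1 x : 0 <= x <= 1 -> kl x (1 / 2) <= 1.
Proof.
move=> x01; rewrite klE ?half_in01//; have -> : 1 - 1 / 2 = 2^-1 :> R by lra.
rewrite div1r lnV ?posrE//; have ln2 : ln 2 <= 1 :> R.
  by have := @le_ln1Dx R 1; rewrite -[1 + 1]/2; apply; rewrite (lt_trans _ ltr01)// ltrN10.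
have : x * ln x <= 0 by rewrite mulr_ge0_le0 ?ln_le0//; lra.
have : (1 - x) * ln (1 - x) <= 0 by rewrite mulr_ge0_le0 ?ln_le0//; lra.
lra.
Qed.

Lemma kl_half_sym x : kl (1 - x) (1 / 2) = kl x (1 / 2).
Proof.
rewrite /kl; have -> : 1 - (1 - x) = x by ring.
have -> : 1 - 1 / 2 = 1 / 2 :> R by lra.
by rewrite addrC.
Qed.

(** The divergence is a log-likelihood ratio: the right-hand side is the likelihood of [k] wins and
    [l] losses at its maximizer [k / (k + l)], divided by its value at [1 / 2]. *)
Lemma expR_natr_mul_kl k l : (0 < k + l)%N ->
  expR ((k + l)%:R * kl (k%:R / (k + l)%:R) (1 / 2)) =
  2 ^+ (k + l) * ((k%:R / (k + l)%:R) ^+ k * (l%:R / (k + l)%:R) ^+ l) :> R.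
Proof.
move=> n0; set n := (k + l)%:R : R.
have n_neq0 : n != 0 by rewrite pnatr_eq0 -lt0n.
have pown p : expR (p%:R * ln (p%:R / n / (1 / 2))) = 2 ^+ p * (p%:R / n) ^+ p :> R.
  have [->|p0] := posnP p; first by rewrite mul0r expR0 !expr0 mulr1.
  rewrite expRM_natl lnK ?posrE ?divr_gt0 ?ltr0n//.
  by rewrite -exprMn; congr (_ ^+ _); rewrite div1r invrK mulrC.
have e1 : 1 - k%:R / n = l%:R / n.
  by apply: (mulIf n_neq0); rewrite mulrBl !divfK// mul1r /n natrD; ring.
rewrite /kl e1 mulrDr ![n * (_ * ln _)]mulrA ![n * (_ / n)]mulrC !divfK//.
have -> : 1 - 1 / 2 = 1 / 2 :> R by lra.
by rewrite expRD !pown exprD; ring.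
Qed.

End Kl.

(** * Finite histories *)

Lemma integral_finite_range (d : measure_display) (T : measurableType d)
    (R : realType) (m : measure T R) (A : set T) (I : finType) (X : T -> I)
    (f : I -> R) :
  measurable A -> (forall i, measurable [set w | X w = i]%classic) ->
  (forall i, 0 <= f i) ->
  (\int[m]_(w in A) (f (X w))%:E =
   \sum_i (f i)%:E * m (A `&` [set w | X w = i])%classic)%E.
Proof.
move=> mA mX f0.
rewrite (eq_integral (fun w =>
  \sum_i (f i)%:E * (\1_[set w | X w = i]%classic w)%:E)%E); last first.
  move=> w _; rewrite (bigD1 (X w))//= big1 ?adde0; last first.
    by move=> i ni; rewrite indicE memNset ?mule0//= => e; rewrite e eqxx in ni.
  by rewrite indicE mem_set// mule1.
have mindic i : measurable_fun A (EFin \o (\1_[set w | X w = i]%classic : T -> R)).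
  exact/measurable_EFinP/measurable_indic.
rewrite ge0_integral_sum//; first last.
- by move=> i w _; rewrite mule_ge0 ?lee_fin.
- by move=> i; exact/measurable_funeM/mindic.
apply: eq_bigr => i _; rewrite ge0_integralZl ?lee_fin//; last exact: mindic.
by rewrite integral_indic// setIC.
Qed.

Section History.
Context {K : nat}.
Implicit Types (tr : nat -> round K) (h : seq (round K)).

(** The list runs over the rounds from 1 to [t], so the statistics at time [t] are functions of
    [hist tr t.-1]. *)
Definition hist tr t : seq (round K) := [seq tr s | s <- iota 1 t].

Lemma size_hist tr t : size (hist tr t) = t.
Proof. by rewrite size_map size_iota. Qed.

Lemma histS tr t : hist tr t.+1 = rcons (hist tr t) (tr t.+1).
Proof. by rewrite /hist -{1}[t.+1]addn1 iotaD map_cat /= cats1 add1n. Qed.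

Lemma hist_eqP (r0 : round K) tr t h : size h = t ->
  hist tr t = h <-> forall s, (1 <= s < t.+1)%N -> tr s = nth r0 h s.-1.
Proof.
move=> sz; split=> [<- [//|s] /andP[_ st]|e].
  by rewrite (nth_map 0%N) ?size_iota// nth_iota.
apply: (@eq_from_nth _ r0); rewrite size_hist ?sz// => i it.
by rewrite (nth_map 0%N) ?size_iota// nth_iota// add1n e.
Qed.

End History.

(** * Expectations as finite sums over histories *)

Section ExpectHistory.
Context {R : realType} {K : nat} {d : measure_display} {Omega : measurableType d}.
Context {P : probability Omega R} {T : nat} {Z : nat -> Omega -> round K}.
Context {mu : 'M[R]_K} {r0 : round K}.
Hypothesis mZ : discrete_process T Z.
Hypothesis bZ : bernoulli_feedback P T Z mu.

Let histset h := [set w | hist (Z^~ w) (size h) = h]%classic.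

Definition hist_prob h : R := fine (P (histset h)).

(** As a finite sum it makes sense for any [F]; [expectation_hist] identifies it with the integral
    when [F] is nonnegative. *)
Definition expect t (F : seq (round K) -> R) : R :=
  \sum_(h : t.-tuple (round K)) hist_prob h * F h.

Lemma measurable_histset h : (size h <= T)%N -> measurable (histset h).
Proof.
elim/last_ind: h => [|h r IHh]; rewrite ?size_rcons => hT.
  rewrite (_ : histset [::] = setT)//.
  by apply/seteqP; split => w.
rewrite (_ : histset _ = histset h `&` [set w | Z (size h).+1 w = r])%classic.
  by apply: measurableI; [apply/IHh/ltnW|apply: mZ].
rewrite /histset; apply/seteqP; split=> w /=; rewrite size_rcons histS.
  by move/rcons_inj => [-> ->].
by move=> [-> ->].
Qed.

Lemma hist_prob_ge0 h : 0 <= hist_prob h.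
Proof. by rewrite fine_ge0. Qed.

Let hist_tuple t w : t.-tuple (round K) :=
  Tuple (introT eqP (size_hist (Z^~ w) t)).

Let hist_tupleE t (h : t.-tuple (round K)) :
  [set w | hist_tuple t w = h]%classic = histset h.
Proof.
rewrite /histset size_tuple; apply/seteqP; split=> w /=.
  by move=> <-.
by move=> e; apply: val_inj.
Qed.

Lemma expectation_hist F : (forall h, 0 <= F h) ->
  ('E_P[fun w => F (hist (Z^~ w) T)] = (expect T F)%:E)%E.
Proof.
move=> F0; rewrite unlock.
rewrite (@integral_finite_range _ _ _ P setT _ (hist_tuple T) (F \o val))//=.
  rewrite -sumEFin; apply: eq_bigr => h _; rewrite setTI hist_tupleE mulrC EFinM.
  by rewrite fineK// fin_num_measure//; apply: measurable_histset; rewrite size_tuple.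
by move=> h; rewrite hist_tupleE; apply: measurable_histset; rewrite size_tuple.
Qed.

Let pairset h p := (histset h `&` [set w | (Z (size h).+1 w).1 = p])%classic.

Let measurable_Z1 t p : (1 <= t <= T)%N -> measurable [set w | (Z t w).1 = p]%classic.
Proof.
move=> tT; rewrite (_ : [set _ | _] =
  [set w | Z t w = (p, true)] `|` [set w | Z t w = (p, false)])%classic.
  by apply: measurableU; apply: mZ.
apply/seteqP; split=> w /=; case: (Z _ w) => q [] /=.
- by move=> ->; left.
- by move=> ->; right.
- by case=> [[->]|].
- by case=> [//|[->]].
Qed.

Let measurable_Z2 t b : (1 <= t <= T)%N -> measurable [set w | (Z t w).2 = b]%classic.
Proof.
move=> tT; rewrite (_ : [set _ | _] =
  \bigcup_(p in [set: 'I_K * 'I_K]) [set w | Z t w = (p, b)])%classic.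
  apply: fin_bigcup_measurable => // p _; exact: mZ.
apply/seteqP; split=> w /=; last by case=> p _ /= ->.
by move=> Zb; exists (Z t w).1 => //=; rewrite -Zb -surjective_pairing.
Qed.

Let measurable_pairset h p : (size h < T)%N -> measurable (pairset h p).
Proof.
by move=> hT; apply: measurableI; [exact/measurable_histset/ltnW|exact: measurable_Z1].
Qed.

Let histset_rcons h p b :
  histset (rcons h (p, b)) = (pairset h p `&` [set w | (Z (size h).+1 w).2 = b])%classic.
Proof.
rewrite /histset; apply/seteqP; split=> w /=; rewrite size_rcons histS.
  by move/rcons_inj => [hw Zw]; split; [split|]; rewrite /= ?Zw.
by case=> -[/= -> <-] <-; rewrite -surjective_pairing.
Qed.

Let pair_prob h p := fine (P (pairset h p)).

Let fineP (A : set Omega) : measurable A -> (fine (P A))%:E = P A.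
Proof. by move=> mA; rewrite fineK// fin_num_measure. Qed.

Let measure_split (A : set Omega) (I : finType) (X : Omega -> I) : measurable A ->
  (forall i, measurable [set w | X w = i]%classic) ->
  fine (P A) = \sum_i fine (P (A `&` [set w | X w = i])%classic).
Proof.
move=> mA mX; apply: EFin_inj; rewrite -sumEFin fineP//.
have := @integral_finite_range _ _ _ P A _ X (fun=> 1) mA mX (fun=> ler01).
rewrite integral_cst// mul1e => ->; apply: eq_bigr => i _.
by rewrite mul1e fineP//; apply: measurableI.
Qed.

Let pair_prob_sum h : (size h < T)%N -> \sum_p pair_prob h p = hist_prob h.
Proof.
move=> hT; rewrite /hist_prob (@measure_split _ _ (fun w => (Z (size h).+1 w).1))//.
  exact/measurable_histset/ltnW.
by move=> p; apply: measurable_Z1.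
Qed.

Let pair_prob_split h p : (size h < T)%N ->
  pair_prob h p = hist_prob (rcons h (p, true)) + hist_prob (rcons h (p, false)).
Proof.
move=> hT; rewrite /pair_prob (@measure_split _ _ (fun w => (Z (size h).+1 w).2)).
- by rewrite big_bool /hist_prob !histset_rcons.
- exact: measurable_pairset.
- by move=> b; apply: measurable_Z2.
Qed.

Let hist_prob_rcons h p b : (size h < T)%N ->
  hist_prob (rcons h (p, b)) =
  (if b then mu p.1 p.2 else 1 - mu p.1 p.2) * pair_prob h p.
Proof.
move=> hT.
have win : hist_prob (rcons h (p, true)) = mu p.1 p.2 * pair_prob h p.
  have past : histset h =
      [set w | forall s, (1 <= s < (size h).+1)%N -> Z s w = nth r0 h s.-1]%classic.
    by rewrite /histset; apply/seteqP; split=> w /=; [move/(hist_eqP r0 _ erefl)|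
      move=> e; apply/(hist_eqP r0 _ erefl)].
  have := @bZ (size h).+1 hT (fun s => nth r0 h s.-1) p.1 p.2.
  rewrite -past -surjective_pairing => /(congr1 fine).
  rewrite -[P (_ `&` [set _ | _.1 = _])%classic]fineP; last exact: measurable_pairset.
  rewrite -EFinM /= => <-.
  rewrite /hist_prob histset_rcons; congr (fine (P _)).
  apply/seteqP; split=> w /= [].
    by case=> hw Z1 Z2; split; rewrite //= [LHS]surjective_pairing Z1 Z2.
  by move=> hw Zw; split; [split|]; rewrite /= ?Zw.
case: b => //; have := pair_prob_split p hT; rewrite win mulrBl mul1r; lra.
Qed.

(** The pair drawn depends on the history and on arbitrary tie-breaking, so the drift condition is
    asked for every pair; only the feedback is averaged with known weights. *)
Lemma expect_drift t F G : (t < T)%N ->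
  (forall h, size h = t -> forall i j,
    mu i j * F (rcons h (i, j, true)) + (1 - mu i j) * F (rcons h (i, j, false))
    <= G h) ->
  expect t.+1 F <= expect t G.
Proof.
move=> tT drift; pose rc (x : t.-tuple (round K) * round K) : t.+1.-tuple (round K) :=
  [tuple of rcons x.1 x.2].
have rc_bij : bijective rc.
  apply: inj_card_bij => [[h r] [h' r'] /(congr1 val)/rcons_inj[/val_inj -> ->]//|].
  by rewrite card_prod !card_tuple expnSr.
rewrite /expect (reindex rc)/=; last exact: onW_bij.
rewrite -(pair_bigA _ (fun (h : t.-tuple (round K)) r =>
  hist_prob (rcons h r) * F (rcons h r)))/=.
apply: ler_sum => h _; have hT : (size h < T)%N by rewrite size_tuple.
rewrite [leLHS](_ : _ = \sum_p \sum_b hist_prob (rcons h (p, b)) * F (rcons h (p, b)));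
  last by rewrite pair_bigA; apply: eq_bigr => -[].
rewrite -pair_prob_sum// mulr_suml; apply: ler_sum => p _.
rewrite big_bool /= !hist_prob_rcons//= -!(mulrAC _ _ (pair_prob _ _)) -mulrDl mulrC.
apply: ler_wpM2l; first by rewrite fine_ge0.
by have := drift h (size_tuple h) p.1 p.2; rewrite -surjective_pairing.
Qed.

Lemma expect0 F : expect 0 F = F [::].
Proof.
rewrite /expect (big_pred1 [tuple]) => [|h]; last by rewrite [h]tuple0; apply/esym/eqP.
rewrite /hist_prob (_ : histset _ = setT) ?probability_setT ?mul1r//.
by apply/seteqP; split.
Qed.

(** A history of positive probability is realized by some outcome, so a comparison known only along
    actual runs is enough. *)
Lemma ler_expect t F G :
  (forall w, F (hist (Z^~ w) t) <= G (hist (Z^~ w) t)) -> expect t F <= expect t G.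
Proof.
move=> FG; apply: ler_sum => h _; have [->|h0] := eqVneq (hist_prob h) 0.
  by rewrite !mul0r.
apply: ler_wpM2l; first exact: hist_prob_ge0.
have /set0P[w] : histset h != set0.
  by apply: contraNneq h0 => e; rewrite /hist_prob e measure0.
by rewrite /histset /= size_tuple => <-.
Qed.

End ExpectHistory.

(** * Laplace mixtures *)

Section Laplace.
Context {R : realType}.

(** The factorials are the Beta integral of [p ^ k * (1 - p) ^ l] over [[0, 1]]. With [a = 1 / m]
    and [b = 1 / (1 - m)] this is the likelihood under a uniform prior divided by the one at [m]. *)
Definition laplace (a b : R) (k l : nat) : R :=
  k`!%:R * l`!%:R / (k + l).+1`!%:R * (a ^+ k * b ^+ l).

Lemma laplace_ge0 a b k l : 0 <= a -> 0 <= b -> 0 <= laplace a b k l.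
Proof. by move=> a0 b0; rewrite /laplace !(mulr_ge0, invr_ge0, exprn_ge0). Qed.

Lemma laplaceSl a b k l :
  laplace a b k.+1 l = laplace a b k l * (a * k.+1%:R / (k + l).+2%:R).
Proof. by rewrite /laplace addSn !factS !natrM exprS !invfM; ring. Qed.

Lemma laplaceSr a b k l :
  laplace a b k l.+1 = laplace a b k l * (b * l.+1%:R / (k + l).+2%:R).
Proof. by rewrite /laplace addnS !factS !natrM exprS !invfM; ring. Qed.

(** A win multiplies the mixture by [a] times the predictive probability [(k + 1) / (k + l + 2)], a
    loss by [b] times the complementary one. The hypotheses cancel [a] and [b] against the true
    probabilities. *)
Lemma laplace_drift (m a b : R) k l : 0 <= a -> 0 <= b ->
  m * a <= 1 -> (1 - m) * b <= 1 ->
  m * laplace a b k.+1 l + (1 - m) * laplace a b k l.+1 <= laplace a b k l.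
Proof.
move=> a0 b0 ma mb; rewrite laplaceSl laplaceSr.
have -> (L x y c : R) : m * (L * (a * x / c)) + (1 - m) * (L * (b * y / c)) =
    L * ((m * a * x + (1 - m) * b * y) / c) by ring.
rewrite -[leRHS]mulr1; apply: ler_wpM2l; first exact: laplace_ge0.
rewrite ler_pdivrMr ?ltr0n// mul1r.
have -> : (k + l).+2%:R = k.+1%:R + l.+1%:R :> R by rewrite -natrD addnS addSn.
by apply: lerD; rewrite -[leRHS]mul1r; apply: ler_wpM2r; rewrite ?ler0n.
Qed.

(* A single term of the binomial expansion of [(k/n + l/n)^n = 1]. *)
Lemma binomial_term_le1 k l : (0 < k + l)%N ->
  (k + l)`!%:R / (k`!%:R * l`!%:R) *
    ((k%:R / (k + l)%:R) ^+ k * (l%:R / (k + l)%:R) ^+ l) <= 1 :> R.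
Proof.
move=> n0; set n := (k + l)%N; set p : R := k%:R / n%:R; set q : R := l%:R / n%:R.
have p0 : 0 <= p by rewrite divr_ge0.
have q0 : 0 <= q by rewrite divr_ge0.
have pq : (p + q) ^+ n = 1.
  by rewrite -mulrDl -natrD divff ?expr1n// pnatr_eq0 -lt0n.
have ln : (l < n.+1)%N by rewrite ltnS leq_addl.
have binE : 'C(n, l)%:R = n`!%:R / (k`!%:R * l`!%:R) :> R.
  apply: (canRL (mulfK _)); first by rewrite mulf_neq0// pnatr_eq0 -lt0n fact_gt0.
  by rewrite -!natrM [(k`! * _)%N]mulnC -[in k`!](addnK l k) bin_fact// leq_addl.
have nl : (n - l)%N = k by rewrite /n addnK.
rewrite -binE mulr_natl -pq exprDn (bigD1 (Ordinal ln))//= nl lerDl.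
by apply: sumr_ge0 => i _; rewrite mulrn_wge0// mulr_ge0// exprn_ge0.
Qed.

(** By [binomial_term_le1], the mixture weight loses only the factor [k + l + 1] against the maximal
    likelihood. Since [k <= l], the bases gather as [(a * b) ^ k * b ^ (l - k)], which leaves
    [r ^ (k + l)] beyond the [2 ^ (k + l)] that comes from the likelihood at [1 / 2]. *)
Lemma laplace_ge (a b r : R) k l : (0 < k + l)%N -> (k <= l)%N ->
  1 < r -> (2 * r) ^+ 2 <= a * b -> 2 * r <= b ->
  r ^+ (k + l) / (k + l).+1%:R *
    expR ((k + l)%:R * kl (k%:R / (k + l)%:R) (1 / 2)) <= laplace a b k l.
Proof.
move=> n0 kl r1 abr br.
have r0 : 0 < 2 * r by lra.
have f0 n : 0 < n`!%:R :> R by rewrite ltr0n fact_gt0.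
have ab_ge : (2 * r) ^+ (k + l) <= a ^+ k * b ^+ l.
  rewrite -(subnKC kl) addnA exprD addnn -mul2n exprM [b ^+ _]exprD mulrA -exprMn.
  by apply: ler_pM; rewrite ?exprn_ge0 ?sqr_ge0 ?(ltW r0)//;
    apply: lerXn2r; rewrite ?nnegrE ?sqr_ge0//; nra.
rewrite expR_natr_mul_kl//; have := binomial_term_le1 n0.
set X := _ ^+ k * _ ^+ l => X1.
have X0 : 0 <= X by rewrite mulr_ge0// exprn_ge0// divr_ge0.
have -> : r ^+ (k + l) / (k + l).+1%:R * (2 ^+ (k + l) * X) =
    X / (k + l).+1%:R * (2 * r) ^+ (k + l) by rewrite exprMn; ring.
rewrite /laplace; apply: ler_pM => //.
- by rewrite divr_ge0.
- by rewrite exprn_ge0// ltW.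
rewrite mulrAC ler_pdivrMr ?mulr_gt0// mul1r in X1.
rewrite factS natrM ler_pdivrMr ?ltr0n// invfM mulrA mulrAC divfK ?pnatr_eq0//.
by rewrite ler_pdivlMr// mulrC.
Qed.

(* The exponent is [1 + e] rather than [1] because, by [1 < r], the mixture
   weight beats the likelihood at [1 / 2] exponentially. *)
Lemma laplace_ge_expR (a b r : R) : 0 <= a -> 0 <= b ->
  1 < r -> (2 * r) ^+ 2 <= a * b -> 2 * r <= b ->
  exists2 e : R, 0 < e & forall e', 0 < e' <= e -> forall k l, (k <= l)%N ->
    e' * expR ((1 + e') * ((k + l)%:R * kl (k%:R / (k + l)%:R) (1 / 2)))
      <= 1 + laplace a b k l.
Proof.
move=> a0 b0 r1 abr br; have r0 : 0 < r by lra.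
have lr0 : 0 < ln r by rewrite ln_gt0.
exists (Num.min 1 (ln r / 2)) => [|e /andP[e0]]; first by rewrite lt_min ltr01 divr_gt0.
rewrite le_min => /andP[e1 er] k l kl.
have [->|n0] := posnP (k + l).
  by rewrite mul0r mulr0 expR0 mulr1 (le_trans e1)// lerDl laplace_ge0.
apply: le_trans (_ : laplace a b k l <= _); last by rewrite lerDr.
apply: le_trans (laplace_ge n0 kl r1 abr br); set n := (k + l)%N.
set D := n%:R * _; rewrite mulrDl mul1r expRD mulrA [leLHS]mulrAC.
rewrite ler_wpM2r ?expR_ge0//.
have x01 : 0 <= (k%:R / n%:R : R) <= 1.
  apply/andP; split; first by rewrite divr_ge0.
  by rewrite ler_pdivrMr ?ltr0n// mul1r ler_nat leq_addr.
have D0 : 0 <= D by rewrite mulr_ge0// kl_ge0// half_in01.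
have Dn : D <= n%:R by rewrite -[leRHS]mulr1 ler_wpM2l// kl_half_le1.
have -> : r ^+ n = expR (n%:R * ln r) by rewrite expRM_natl lnK.
rewrite ler_pdivlMr ?ltr0n//.
(* One half of the exponent [n * ln r] pays for [e * (n + 1)], the other for [expR (e * D)], as
   [D <= n]. *)
apply: (@le_trans _ _ ((1 + n%:R * (ln r / 2)) * expR (n%:R * (ln r / 2)))).
  rewrite mulrAC; apply: ler_pM.
  - by rewrite mulr_ge0// ltW.
  - exact: expR_ge0.
  - rewrite -natr1; have := ler0n R n; nra.
  - rewrite ler_expR mulrC; by apply: ler_pM => //; exact: ltW.
have -> : n%:R * ln r = n%:R * (ln r / 2) + n%:R * (ln r / 2) by field.
by rewrite expRD ler_wpM2r ?expR_ge0// expR_ge1Dx.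
Qed.

(** For [m < 1] the bases are the inverse probabilities, with [2 * r] their geometric mean, which
    exceeds 2 because [m * (1 - m) < 1 / 4]. *)
Lemma likelihood_ratio_bases (m : R) : 1 / 2 < m <= 1 ->
  exists a b r : R, [/\ 0 <= a, 0 <= b, m * a <= 1, (1 - m) * b <= 1 &
    [/\ 1 < r, (2 * r) ^+ 2 <= a * b & 2 * r <= b]].
Proof.
move=> /andP[m2]; rewrite le_eqVlt => /predU1P[->|m1].
  (* For [m = 1] a loss has probability 0, so [b] may be any large number. *)
  by exists 1, 16, 2; split; [lra..|split; lra].
have q0 : 0 < 1 - m by lra.
have m0 : 0 < m by lra.
have mq0 : 0 < m * (1 - m) by rewrite mulr_gt0.
pose s := Num.sqrt (m * (1 - m))^-1.
have s2 : s ^+ 2 = (m * (1 - m))^-1 by rewrite sqr_sqrtr// invr_ge0 ltW.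
have s0 : 0 <= s by rewrite sqrtr_ge0.
exists m^-1, (1 - m)^-1, (s / 2); split.
- by rewrite invr_ge0 ltW.
- by rewrite invr_ge0 ltW.
- by rewrite divff// gt_eqF.
- by rewrite divff// gt_eqF.
have -> : 2 * (s / 2) = s by field.
have mq4 : 4 < (m * (1 - m))^-1.
  have : 0 < (m - 1 / 2) * (m - 1 / 2) by rewrite mulr_gt0//; lra.
  move=> sq; rewrite -[ltLHS]invrK ltf_pV2 ?posrE ?invr_gt0//.
  lra.
split; first by rewrite -s2 in mq4; nra.
- by rewrite s2 invfM.
- rewrite -(@ler_pXn2r _ 2)// ?nnegrE ?invr_ge0 ?(ltW q0)// s2 exprVn.
  by rewrite lef_pV2 ?posrE ?exprn_gt0//; nra.
Qed.

(** A discrete integral comparison of [t ^ (- 1 - e)] with the increments of [t ^ (- e)]; the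
    constant leaves room for the crude bound [ln (t + 1) - ln t >= 1 / (2 * t)]. *)
Lemma riemann_telescope (e : R) (t : nat) : 0 < e -> (0 < t)%N ->
  expR (- ((1 + e) * ln t%:R)) <=
  2 * (1 + e) / e * (expR (- (e * ln t%:R)) - expR (- (e * ln t.+1%:R))).
Proof.
move=> e0 t0; set u := ln t%:R; set v := ln t.+1%:R.
have T0 : 0 < t%:R :> R by rewrite ltr0n.
have T1 : 1 <= t%:R :> R by rewrite ler1n.
have vu : (2 * t%:R)^-1 <= v - u.
  have := @le_ln1Dx R (t%:R / t.+1%:R - 1).
  have -> : 1 + (t%:R / t.+1%:R - 1) = t%:R / t.+1%:R :> R by ring.
  rewrite ln_div ?posrE ?ltr0n// -/u -/v.
  have -> : t%:R / t.+1%:R - 1 = - t.+1%:R^-1 :> R.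
    by rewrite -natr1; field; lra.
  have : t.+1%:R^-1 < 1 :> R by rewrite invf_lt1 ?ltr0n// ltr1n.
  have : (2 * t%:R)^-1 <= t.+1%:R^-1 :> R.
    by rewrite lef_pV2 ?posrE ?ltr0n ?mulr_gt0// -natr1; lra.
  move=> h1 h2 h; have h3 : -1 < - t.+1%:R^-1 :> R by rewrite ltrN2.
  by rewrite -lerN2 opprB; apply: le_trans (h h3) _; rewrite lerN2.
pose x := e * (2 * t%:R)^-1.
have x0 : 0 < x by rewrite mulr_gt0// invr_gt0 mulr_gt0.
have xe : x <= e.
  by apply: ler_piMr; [exact: ltW|rewrite invf_le1 ?mulr_gt0//; lra].
have expx : expR (- (e * v)) <= expR (- (e * u)) * (1 + x)^-1.
  apply: (@le_trans _ _ (expR (- (e * u)) * expR (- x))).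
    rewrite -expRD ler_expR /x -opprD lerN2 -mulrDr.
    by apply: ler_wpM2l; [exact: ltW|lra].
  rewrite ler_wpM2l ?expR_ge0// expRN lef_pV2 ?posrE ?expR_gt0 ?expR_ge1Dx//; lra.
have -> : expR (- ((1 + e) * u)) = expR (- (e * u)) * t%:R^-1.
  by rewrite mulrDl mul1r opprD expRD [expR (- u)]expRN lnK ?posrE// mulrC.
apply: (@le_trans _ _ (2 * (1 + e) / e *
  (expR (- (e * u)) * (1 - (1 + x)^-1)))); last first.
  apply: ler_wpM2l; first by rewrite mulr_ge0 ?invr_ge0 ?(ltW e0)//; lra.
  by rewrite mulrBr mulr1 lerB.
rewrite mulrCA ler_wpM2l ?expR_ge0//.
have -> : 1 - (1 + x)^-1 = x / (1 + x) by field; lra.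
rewrite mulrA ler_pdivlMr; last lra.
have -> : 2 * (1 + e) / e * x = (1 + e) * t%:R^-1 by rewrite /x; field; lra.
by rewrite mulrC; apply: ler_wpM2r; [rewrite invr_ge0 ltW|lra].
Qed.

End Laplace.

(** * Potential functions *)

Section Counts.
Context {K : nat}.
Implicit Types (i j : 'I_K) (h : seq (round K)) (r : round K).

Definition wins i j h : nat := count (fun r => preferred r i j) h.

Lemma wins_rcons i j h r : wins i j (rcons h r) = (wins i j h + preferred r i j)%N.
Proof. by rewrite /wins -cats1 count_cat /= addn0. Qed.

Lemma compared_sym r i j : compared r i j = compared r j i.
Proof. exact: orbC. Qed.

Lemma preferredN r i j : ~~ compared r i j -> preferred r i j = false.
Proof.
case: r => p b; rewrite /compared /preferred /= !xpair_eqE negb_or.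
by move=> /andP[/negbTE -> /negbTE ->].
Qed.

Lemma preferred_winner p b i j : i != j -> compared (p, b) i j ->
  preferred (p, b) i j = (b == (p == (i, j))).
Proof.
move=> ij; rewrite /compared /preferred /= => /orP[] /eqP ->.
  by rewrite !xpair_eqE !eqxx (negbTE ij) /= orbF.
by rewrite !xpair_eqE !eqxx eq_sym (negbTE ij) /=; case: b.
Qed.

Lemma preferredD r i j : i != j ->
  (preferred r i j + preferred r j i)%N = compared r i j.
Proof.
move=> ij; have [cmp|ncmp] := boolP (compared r i j); last first.
  by rewrite !preferredN// compared_sym.
have ji : j != i by rewrite eq_sym.
case: r cmp => p b cmp; have cmp' : compared (p, b) j i by rewrite compared_sym.
rewrite (preferred_winner ij cmp) (preferred_winner ji cmp').
move: cmp; rewrite /compared /= => /orP[] /eqP ->.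
  by rewrite !xpair_eqE !eqxx (negbTE ij); case: b {cmp'}.
by rewrite !xpair_eqE !eqxx (negbTE ji); case: b {cmp'}.
Qed.

Context {R : realType} (r0 : round K).

(** The counts are those before the draw [r]. The product form makes the first draw of a pair count
    as low. *)
Definition low_visit i j (y : R) h r : bool :=
  compared r i j && ((wins i j h)%:R <= y * (wins i j h + wins j i h)%:R)%R.

Definition accum (c : seq (round K) -> round K -> R) h : R :=
  \sum_(s < size h) c (take s h) (nth r0 h s).

Lemma accum_nil c : accum c [::] = 0.
Proof. by rewrite /accum big_ord0. Qed.

Lemma accum_rcons c h r : accum c (rcons h r) = accum c h + c h r.
Proof.
rewrite /accum size_rcons big_ord_recr /= nth_rcons ltnn eqxx; congr (_ + _).
  by apply: eq_bigr => s _; rewrite nth_rcons ltn_ord -cats1 takel_cat// ltnW.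
by rewrite -cats1 take_size_cat.
Qed.

Lemma accum_hist c tr T :
  accum c (hist tr T) = \sum_(1 <= t < T.+1) c (hist tr t.-1) (tr t).
Proof.
elim: T => [|T IH]; first by rewrite accum_nil big_geq.
by rewrite histS accum_rcons IH [RHS]big_nat_recr.
Qed.

Section PairDrift.
Context {mu : 'M[R]_K}.
Hypothesis hmu : preference_matrix mu.

(** Draws of other pairs leave the counts unchanged, and a draw in the order [(j, i)] swaps the
    outcomes, by [mu j i = 1 - mu i j]. Thus the drift is only checked for [(i, j)]; [c] is the cost
    charged to a draw of the pair. *)
Lemma pair_drift i j (g c : nat -> nat -> R) h x y : i != j ->
  (forall k l, c k l + (mu i j * g k.+1 l + (1 - mu i j) * g k l.+1) <= g k l) ->
  let h1 := rcons h (x, y, true) in let h0 := rcons h (x, y, false) in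
  is_true ((compared (x, y, true) i j)%:R * c (wins i j h) (wins j i h) +
    (mu x y * g (wins i j h1) (wins j i h1) + (1 - mu x y) * g (wins i j h0) (wins j i h0))
  <= g (wins i j h) (wins j i h)).
Proof.
move=> ij drift h1 h0; have [_ mu_anti _] := hmu.
have ji : j != i by rewrite eq_sym.
rewrite /h1 /h0 !wins_rcons.
have [cmp|ncmp] := boolP (compared (x, y, true) i j); last first.
  have ncmp' : ~~ compared (x, y, false) i j by [].
  rewrite ![preferred _ i j]preferredN// ![preferred _ j i]preferredN 1?compared_sym//.
  by rewrite !addn0 mul0r add0r -mulrDl addrC subrK mul1r.
have cmp' : compared (x, y, false) i j by [].
rewrite ![preferred _ i j]preferred_winner//.
rewrite ![preferred _ j i]preferred_winner 1?compared_sym//.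
rewrite mul1r; move: cmp; rewrite /compared /= !xpair_eqE => /orP[] /andP[/eqP -> /eqP ->].
  by rewrite !eqxx (negbTE ij) /= !addn1 !addn0 drift.
rewrite !eqxx (negbTE ji) /= !addn1 !addn0.
apply: le_trans (drift (wins i j h) (wins j i h)).
by rewrite lerD2l addrC (mu_anti j i) opprB addrCA subrr addr0.
Qed.

End PairDrift.
End Counts.

Section Potentials.
Context {R : realType} {K : nat} {d : measure_display} {Omega : measurableType d}.
Context {P : probability Omega R} {T : nat} {Z : nat -> Omega -> round K}.
Context {mu : 'M[R]_K} {r0 : round K}.
Hypothesis mZ : discrete_process T Z.
Hypothesis bZ : bernoulli_feedback P T Z mu.
Hypothesis hmu : preference_matrix mu.

Let E t F := @expect R K d Omega P Z t F.

Lemma expect_potential F :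
  (forall h x y, mu x y * F (rcons h (x, y, true))
    + (1 - mu x y) * F (rcons h (x, y, false)) <= F h) ->
  E T F <= F [::].
Proof.
move=> drift; suff : forall t, (t <= T)%N -> E t F <= F [::] by apply.
elim=> [_|t IH tT]; first by rewrite /E expect0.
apply: le_trans (IH (ltnW tT)).
by apply: (expect_drift (r0 := r0) mZ bZ tT) => h _ x y; apply: drift.
Qed.

(** Each cost is paid out of the mean drop of the potential, so accumulated cost plus potential
    decreases in mean; the final potential is discarded by nonnegativity. *)
Lemma expect_accum_le c Phi : (forall h, 0 <= Phi h) ->
  (forall h x y, c h (x, y, true) = c h (x, y, false)) ->
  (forall h x y, c h (x, y, true) + (mu x y * Phi (rcons h (x, y, true))
    + (1 - mu x y) * Phi (rcons h (x, y, false))) <= Phi h) ->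
  E T (accum r0 c) <= Phi [::].
Proof.
move=> Phi0 cE drift; apply: (@le_trans _ _ (E T (fun h => accum r0 c h + Phi h))).
  by apply: ler_expect => w; rewrite lerDl.
rewrite -[leRHS]add0r -[X in X + _](accum_nil r0 c).
apply: (@expect_potential (fun h => accum r0 c h + Phi h)) => h x y.
by rewrite !accum_rcons -cE; have := drift h x y; lra.
Qed.

Lemma expect_visits (i j : 'I_K) (y lam : R) : i != j -> 0 <= lam ->
  let theta := mu i j * expR (- (lam * (1 - y))) + (1 - mu i j) * expR (lam * y) in
  theta < 1 ->
  E T (accum r0 (fun h r => (low_visit i j y h r)%:R)) <= (1 - theta)^-1.
Proof.
move=> ij lam0 theta theta1.
(* A draw multiplies the mean of the exponential by [theta]. Dividing by [1 - theta] makes the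
   potential drop by the exponential itself, which is at least 1 at a low draw. *)
pose g k l : R := (1 - theta)^-1 * expR (- (lam * (k%:R - y * (k + l)%:R))).
have th0 : 0 < (1 - theta)^-1 by rewrite invr_gt0; lra.
have -> : (1 - theta)^-1 = g 0%N 0%N by rewrite /g mulr0 subr0 mulr0 oppr0 expR0 mulr1.
apply: (@expect_accum_le _ (fun h => g (wins i j h) (wins j i h))) => //.
- by move=> h; rewrite mulr_ge0 ?expR_ge0// ltW.
move=> h x z; rewrite /low_visit -mulnb natrM.
apply: (pair_drift hmu (c := fun k l => (k%:R <= y * (k + l)%:R)%R%:R)) => // k l.
have -> : mu i j * g k.+1 l + (1 - mu i j) * g k l.+1 = theta * g k l.
  rewrite /g /theta -addSnnS !addSn -!natr1.
  have -> : - (lam * (k%:R + 1 - y * ((k + l)%:R + 1))) =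
    - (lam * (1 - y)) + - (lam * (k%:R - y * (k + l)%:R)) by ring.
  have -> : - (lam * (k%:R - y * ((k + l)%:R + 1))) =
    lam * y + - (lam * (k%:R - y * (k + l)%:R)) by ring.
  by rewrite !expRD; ring.
rewrite -lerBrDr -[X in X - _]mul1r -mulrBl /g mulrA divff ?mul1r; last by lra.
have [le|_] := boolP (k%:R <= y * (k + l)%:R); last exact: expR_ge0.
by rewrite -[1%:R]expR0 ler_expR oppr_ge0 mulr_ge0_le0//; lra.
Qed.

Lemma expect_visits_quadratic (i j : 'I_K) (y : R) : i != j -> 0 <= y < mu i j ->
  E T (accum r0 (fun h r => (low_visit i j y h r)%:R))
  <= 8 / (mu i j - y) ^+ 2.
Proof.
have [mu01 _ _] := hmu; move=> ij /andP[y0 ym]; have /andP[m0 m1] := mu01 i j.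
(* [lam] minimizes [1 - lam * (m - y) + 2 * lam ^ 2], an upper bound for [theta]. *)
set m := mu i j in ym m0 m1 *; pose lam := (m - y) / 4.
have exp_le u : u <= 1 / 2 -> expR u <= 1 + u + 2 * u ^+ 2.
  move=> u2; have e1 := expR_ge1Dx (- u).
  rewrite -[u in expR u]opprK expRN -div1r ler_pdivrMr ?expR_gt0//.
  have q0 : 0 <= 1 + u + 2 * u ^+ 2 by nra.
  apply: (@le_trans _ _ ((1 + u + 2 * u ^+ 2) * (1 + - u))); last exact: ler_wpM2l.
  have : 0 <= u ^+ 2 * (1 - 2 * u) by rewrite mulr_ge0 ?sqr_ge0//; lra.
  by rewrite -subr_ge0; congr (0 <= _); ring.
have lam0 : 0 < lam by rewrite /lam; lra.
have theta_le : m * expR (- (lam * (1 - y))) + (1 - m) * expR (lam * y) <=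
    1 - (m - y) ^+ 2 / 8.
  have h1 : m * expR (- (lam * (1 - y))) <=
      m * (1 + - (lam * (1 - y)) + 2 * (- (lam * (1 - y))) ^+ 2).
    by apply: ler_wpM2l => //; apply: exp_le; rewrite /lam; nra.
  have h2 : (1 - m) * expR (lam * y) <= (1 - m) * (1 + lam * y + 2 * (lam * y) ^+ 2).
    by apply: ler_wpM2l; [lra|apply: exp_le; rewrite /lam; nra].
  apply: le_trans (lerD h1 h2) _.
  have s1 : m * (1 - y) ^+ 2 <= m by rewrite ler_piMr// expr_le1//; lra.
  have s2 : (1 - m) * y ^+ 2 <= 1 - m by rewrite ler_piMr ?expr_le1//; lra.
  have s3 : lam ^+ 2 * (m * (1 - y) ^+ 2 + (1 - m) * y ^+ 2) <= lam ^+ 2.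
    by apply: ler_piMr; [exact: sqr_ge0|lra].
  have -> : m * (1 + - (lam * (1 - y)) + 2 * (- (lam * (1 - y))) ^+ 2) +
    (1 - m) * (1 + lam * y + 2 * (lam * y) ^+ 2) = 1 - lam * (m - y) +
    2 * (lam ^+ 2 * (m * (1 - y) ^+ 2 + (1 - m) * y ^+ 2)) by ring.
  have -> : (m - y) ^+ 2 / 8 = lam * (m - y) - 2 * lam ^+ 2 by rewrite /lam; field.
  lra.
have sq0 : 0 < (m - y) ^+ 2 by rewrite exprn_gt0//; lra.
apply: (le_trans (expect_visits ij (ltW lam0) _)); first by rewrite -/m; lra.
rewrite -[8 / _]invf_div lef_pV2 ?posrE; last by rewrite divr_gt0.
  by rewrite -/m; lra.
by rewrite -/m; lra.
Qed.

(** When [i] always wins, the rate [lam = 1 / (1 - y)] gives [theta = expR (- 1)], hence a bound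
    uniform in [y]; the quadratic bound would be only [8 / (1 - y) ^ 2]. *)
Lemma expect_visits_certain (i j : 'I_K) (y : R) : i != j -> y < 1 -> mu i j = 1 ->
  E T (accum r0 (fun h r => (low_visit i j y h r)%:R)) <= 2.
Proof.
move=> ij y1 m1; have y0 : 0 < 1 - y by lra.
have e2 : expR (- 1) <= 1 / 2 :> R.
  by rewrite expRN div1r lef_pV2 ?posrE ?expR_gt0//; have := expR_ge1Dx (1 : R); lra.
have theta_le : mu i j * expR (- ((1 - y)^-1 * (1 - y))) +
    (1 - mu i j) * expR ((1 - y)^-1 * y) <= 1 / 2.
  by rewrite m1 subrr mul0r addr0 mul1r mulVf ?gt_eqF.
apply: le_trans (expect_visits ij (_ : 0 <= (1 - y)^-1) _) _.
- by rewrite invr_ge0 ltW.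
- by lra.
rewrite -[leRHS]invrK lef_pV2 ?posrE ?invr_gt0//; lra.
Qed.

End Potentials.

(** * A supermartingale against large divergence of the Condorcet winner *)

Lemma exists_common_eps (R : realType) (I : finType) (p : pred I) (Q : I -> R -> Prop) :
  (forall i, p i -> exists2 e : R, 0 < e & forall e', 0 < e' <= e -> Q i e') ->
  exists2 e : R, 0 < e <= 1 & forall i, p i -> Q i e.
Proof.
move=> H; have {H} /choice[u uP] i : exists e : R, 0 < e /\
    (p i -> forall e', 0 < e' <= e -> Q i e').
  have [pi|_] := boolP (p i); last by exists 1.
  by have [e e0 He] := H i pi; exists e.
exists (\big[Num.min/1]_i u i) => [|i pi].
  by rewrite bigmin_le_id andbT; elim/big_ind: _ => // [x y x0 y0|i _];
    [rewrite lt_min x0|case: (uP i)].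
have [_ /(_ pi)] := uP i; apply; rewrite bigmin_le_cond// andbT.
by elim/big_ind: _ => // [x y x0 y0|j _]; [rewrite lt_min x0|case: (uP j)].
Qed.

Section Supermartingale.
Context {R : realType} {K : nat} {d : measure_display} {Omega : measurableType d}.
Context {P : probability Omega R} {T : nat} {Z : nat -> Omega -> round K}.
Context {mu : 'M[R]_K} {r0 : round K}.
Hypothesis mZ : discrete_process T Z.
Hypothesis bZ : bernoulli_feedback P T Z mu.
Hypothesis hmu : preference_matrix mu.

Section Product.
Variables (w : 'I_K) (g : 'I_K -> nat -> nat -> R).
Hypothesis g_ge0 : forall s k l, 0 <= g s k l.
Hypothesis g_drift : forall s, s != w -> forall k l,
  mu w s * g s k.+1 l + (1 - mu w s) * g s k l.+1 <= g s k l.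

Definition pair_product (h : seq (round K)) : R :=
  \prod_(s | s != w) g s (wins w s h) (wins s w h).

Lemma pair_product_ge0 h : 0 <= pair_product h.
Proof. exact: prodr_ge0. Qed.

(** A draw changes the counts of at most one pair [{w, s}], so at most one factor of the product
    moves. *)
Lemma pair_product_drift h x y :
  mu x y * pair_product (rcons h (x, y, true)) +
    (1 - mu x y) * pair_product (rcons h (x, y, false)) <= pair_product h.
Proof.
have other s b : ~~ compared (x, y, true) w s ->
    g s (wins w s (rcons h (x, y, b))) (wins s w (rcons h (x, y, b))) =
    g s (wins w s h) (wins s w h).
  move=> ncmp; have ncmp' : ~~ compared (x, y, b) w s by [].
  by rewrite !wins_rcons !preferredN ?addn0// compared_sym.
have [s /andP[sw cmp]|none] :=
    pickP [pred s | (s != w) && compared (x, y, true) w s]; last first.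
  have same b : pair_product (rcons h (x, y, b)) = pair_product h.
    apply: eq_bigr => s sw; apply: other.
    by have := none s; rewrite /= sw /= => ->.
  by rewrite !same -mulrDl addrC subrK mul1r.
have ws : w != s by rewrite eq_sym.
have others b : \prod_(s' | (s' != w) && (s' != s))
      g s' (wins w s' (rcons h (x, y, b))) (wins s' w (rcons h (x, y, b))) =
    \prod_(s' | (s' != w) && (s' != s)) g s' (wins w s' h) (wins s' w h).
  apply: eq_bigr => s' /andP[s'w s's]; apply: other; apply: contra s's => cmp'.
  move: cmp cmp'; rewrite /compared /= !xpair_eqE.
  case/orP => /andP[/eqP -> /eqP ->] /orP[] /andP[/eqP e1 /eqP e2].
  - by rewrite e2.
  - by rewrite -e1 eqxx in s'w.
  - by rewrite e1 eqxx in sw.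
  - by rewrite e1.
rewrite /pair_product !(bigD1 s sw) /= !others !mulrA -mulrDl.
apply: ler_wpM2r; first by apply: prodr_ge0.
have := pair_drift hmu (g := g s) (c := fun _ _ => 0) h x y ws.
by rewrite /= mulr0 add0r; apply => k l; rewrite add0r; apply: g_drift.
Qed.

(** The potential multiplies the product by [rho], which bounds the remaining sum of
    [t ^ (- 1 - e)]; by [riemann_telescope] its decrease pays for the current round. *)
Lemma expect_pair_product (e : R) : 0 < e ->
  @expect R K d Omega P Z T (accum r0 (fun h _ =>
    pair_product h * expR (- ((1 + e) * ln (size h).+1%:R))))
  <= 2 * (1 + e) / e * pair_product [::].
Proof.
move=> e0; pose rho t : R := 2 * (1 + e) / e * expR (- (e * ln t%:R)).
have ce0 : 0 <= 2 * (1 + e) / e by rewrite divr_ge0// ?ltW//; lra.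
have -> : 2 * (1 + e) / e * pair_product [::] =
    pair_product [::] * rho (size ([::] : seq (round K))).+1.
  by rewrite /rho ln1 mulr0 oppr0 expR0 mulr1 mulrC.
apply: (expect_accum_le mZ bZ (Phi := fun h => pair_product h * rho (size h).+1)) => //.
  by move=> h; rewrite mulr_ge0 ?pair_product_ge0// mulr_ge0// expR_ge0.
move=> h x y; rewrite !size_rcons.
have rho0 : 0 <= rho (size h).+2 by rewrite mulr_ge0// expR_ge0.
have dr := ler_wpM2r rho0 (pair_product_drift h x y).
have te := riemann_telescope e0 (ltn0Sn (size h)).
have := ler_wpM2l (pair_product_ge0 h) te.
rewrite mulrBr -/(rho _) -/(rho _) mulrBr => ht.
by rewrite mulrDl in dr; rewrite -!mulrA in dr *; lra.
Qed.

End Product.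

Definition low_divergence (w : 'I_K) (h : seq (round K)) : R :=
  \sum_(s | (s != w) && (wins w s h <= wins s w h)%N)
    (wins w s h + wins s w h)%:R *
      kl ((wins w s h)%:R / (wins w s h + wins s w h)%:R) (1 / 2).

Definition low_divergence_exceeds (w : 'I_K) h : bool :=
  ln (size h).+1%:R < low_divergence w h.

End Supermartingale.

(** A Markov argument: the product of the factors [1 + laplace] is at least a constant times
    [t ^ (1 + e)] when the divergence exceeds [ln t], while its mean stays bounded. The constant is
    fixed before [T] and the probability space. *)
Lemma expect_low_divergence_exceeds (R : realType) (K : nat) (mu : 'M[R]_K)
    (w : 'I_K) (r0 : round K) : preference_matrix mu -> condorcet_winner mu w ->
  exists C : R, 0 <= C /\ forall (d : measure_display) (Omega : measurableType d)
    (P : probability Omega R) (T : nat) (Z : nat -> Omega -> round K),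
    discrete_process T Z -> bernoulli_feedback P T Z mu ->
    @expect R K d Omega P Z T
      (accum r0 (fun h _ => (@low_divergence_exceeds R K w h)%:R)) <= C.
Proof.
move=> hmu hw; have [mu01 _ _] := hmu.
pose good s (abr : R * R * R) := let: (a, b, r) := abr in
  [/\ 0 <= a, 0 <= b, mu w s * a <= 1, (1 - mu w s) * b <= 1 &
    [/\ 1 < r, (2 * r) ^+ 2 <= a * b & 2 * r <= b]].
have /choice[base baseP] s : exists abr, s != w -> good s abr.
  have [->|sw] := eqVneq s w; first by exists (0, 0, 0).
  have [|a [b [r H]]] := @likelihood_ratio_bases R (mu w s); last by exists (a, b, r).
  by rewrite hw// => /=; case/andP: (mu01 w s).
pose a s := (base s).1.1; pose b s := (base s).1.2.
have ab s : s != w -> [/\ 0 <= a s, 0 <= b s, mu w s * a s <= 1 & (1 - mu w s) * b s <= 1].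
  by move=> /baseP; rewrite /a /b; case: (base s) => -[? ?] ? [].
have [e /andP[e0 e1] lapP] : exists2 e : R, 0 < e <= 1 & forall s, s != w ->
    forall k l, (k <= l)%N ->
    e * expR ((1 + e) * ((k + l)%:R * kl (k%:R / (k + l)%:R) (1 / 2)))
      <= 1 + laplace (a s) (b s) k l.
  apply: (@exists_common_eps R 'I_K (fun s => s != w) (fun s e => forall k l, (k <= l)%N ->
    e * expR ((1 + e) * ((k + l)%:R * kl (k%:R / (k + l)%:R) (1 / 2)))
      <= 1 + laplace (a s) (b s) k l)) => s /baseP.
  rewrite /a /b; case: (base s) => -[a' b'] r'.
  by case=> a0 b0 _ _ [r1 abr br]; apply: laplace_ge_expR abr br.
(* The factor [(s != w)%:R] keeps [g] at least 1 at [s = w], where the bases are unspecified. *)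
pose g s k l := 1 + (s != w)%:R * laplace (a s) (b s) k l.
have gE s k l : s != w -> g s k l = 1 + laplace (a s) (b s) k l.
  by rewrite /g => ->; rewrite mul1r.
have g1 s k l : 1 <= g s k l.
  have [->|sw] := eqVneq s w; first by rewrite /g eqxx mul0r addr0.
  by have [? ? _ _] := ab _ sw; rewrite gE// lerDl laplace_ge0.
have g0 s k l : 0 <= g s k l by apply: le_trans (g1 s k l).
have gdrift s : s != w -> forall k l,
    mu w s * g s k.+1 l + (1 - mu w s) * g s k l.+1 <= g s k l.
  move=> sw k l; rewrite !gE//; have [? ? ? ?] := ab _ sw.
  have := @laplace_drift R (mu w s) (a s) (b s) k l; lra.
(* Each factor dominates its exponential only after multiplying the latter by [e]; [c] collects
   these losses. *)
pose c : R := e ^+ #|[pred s | s != w]|.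
have c0 : 0 < c by rewrite exprn_gt0.
exists (c^-1 * (2 * (1 + e) / e * pair_product w g [::])); split.
  apply: mulr_ge0; first by rewrite invr_ge0 ltW.
  apply: mulr_ge0; last exact: pair_product_ge0.
  by rewrite divr_ge0// ?ltW//; lra.
move=> d Omega P T Z mZ bZ.
have key h : (@low_divergence_exceeds R K w h)%:R <=
    c^-1 * (pair_product w g h * expR (- ((1 + e) * ln (size h).+1%:R))).
  have M0 : 0 <= c^-1 * (pair_product w g h * expR (- ((1 + e) * ln (size h).+1%:R))).
    by rewrite !mulr_ge0 ?expR_ge0 ?pair_product_ge0// invr_ge0 ltW.
  have [lt|_] := boolP (low_divergence_exceeds w h); last exact: M0.
  rewrite mulrA -ler_pdivrMr ?expR_gt0// expRN invrK mul1r.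
  rewrite ler_pdivlMl//; apply: (@le_trans _ _ (c * expR ((1 + e) * low_divergence w h))).
    apply: ler_wpM2l; first exact: ltW.
    by rewrite ler_expR ler_wpM2l// ?ltW//; lra.
  have -> : c = \prod_(s | s != w) e by rewrite /c -prodr_const; apply: eq_bigl.
  rewrite /low_divergence big_mkcondr /= mulr_sumr expR_sum -big_split /=.
  apply: ler_prod => s sw; rewrite mulr_ge0 ?expR_ge0 ?(ltW e0)//= gE//.
  case: ifPn => [le|_]; first exact: lapP.
  by rewrite mulr0 expR0 mulr1 -gE// (le_trans e1).
apply: le_trans (_ : _ <= @expect R K d Omega P Z T (fun h => c^-1 * accum r0 (fun h _ =>
    pair_product w g h * expR (- ((1 + e) * ln (size h).+1%:R))) h)) _.
  apply: ler_expect => o; rewrite /accum mulr_sumr; apply: ler_sum => s _; exact: key.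
have -> F : @expect R K d Omega P Z T (fun h => c^-1 * F h) =
    c^-1 * @expect R K d Omega P Z T F.
  by rewrite /expect mulr_sumr; apply: eq_bigr => h _; rewrite mulrCA.
apply: ler_wpM2l; first by rewrite invr_ge0 ltW.
exact: (expect_pair_product (r0 := r0) mZ bZ hmu).
Qed.

(** * Loops of the algorithm *)

Section Loops.
Context {R : realType} {K : nat} {fK : R} {T : nat} {tr : nat -> round K}.
Context {S : nat -> loop_state K}.
Hypothesis S_start : loop_start [set: 'I_K]%SET (S (Tinit K).+1).
Hypothesis S_step : forall t, (Tinit K < t <= T)%N -> main_round fK tr t (S t) (S t.+1).

Definition recommended t (j : 'I_K) : Prop :=
  exists istar, is_istar R tr t istar /\ eventJ tr t fK istar j.

(* [u] is the first round of the loop that contains round [t]. *)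
Definition loop_invariant t u : Prop :=
  [/\ (Tinit K < u <= t)%N /\ (size (todo (S t)) + (t - u) <= K)%N,
      uniq (todo (S t)),
      LR (S t) = [set x in todo (S t)]%SET,
      forall j, j \in LN (S t) -> exists2 t', (u <= t' < t)%N & recommended t' j &
      u = (Tinit K).+1 \/ forall j, j \in todo (S t) ->
        exists2 t', (Tinit K < t' < u)%N && (u <= t' + K)%N & recommended t' j].

Lemma loop_startP (L : {set 'I_K}) s : loop_start L s ->
  [/\ uniq (todo s), (size (todo s) <= K)%N, LR s = [set x in todo s]%SET,
      todo s =i L & LN s = finset.set0].
Proof.
move=> [pe -> ->]; have mem_todo : todo s =i L.
  by move=> x; rewrite (perm_mem pe) mem_enum.
split=> //.
- by rewrite (perm_uniq pe) enum_uniq.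
- by rewrite (perm_size pe) -cardE -[leqRHS]card_ord max_card.
- by apply/setP => x; rewrite inE mem_todo.
Qed.

Lemma loop_invariantP t : (Tinit K < t <= T.+1)%N -> exists u, loop_invariant t u.
Proof.
elim: t => // t IH /andP[tI tT].
have [lt|] := ltnP (Tinit K) t; last first.
  move=> ge; have <- : (Tinit K).+1 = t.+1 by lia.
  have [? sz ? _ LN0] := loop_startP S_start.
  exists (Tinit K).+1; split=> //; last by left.
  - by split; lia.
  - by move=> j; rewrite LN0 inE.
have [|u [[ut szt] un lr ln td]] := IH; first by rewrite lt ltnW.
have [|istar [rest [ist todoE _]]] := @S_step t; first by rewrite lt -ltnS.
set l := (tr t).1.1; cbv zeta; set LR' := (_ :\ _)%SET; set LN' := (_ :|: _)%SET.
have LN'P j : j \in LN' -> exists2 t', (u <= t' < t.+1)%N & recommended t' j.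
  rewrite /LN' !inE => /orP[/ln[t' t'P rec]|/andP[_ J]].
    by exists t' => //; lia.
  by exists t; [lia|exists istar].
rewrite todoE /= in szt un; have /andP[l_rest un_rest] := un.
case: rest => [|l' rest] in todoE szt un l_rest un_rest *.
  move=> /loop_startP[un' sz' lr' td' ln']; exists t.+1; split=> //.
  - by split; lia.
  - by move=> j; rewrite ln' inE.
  - right=> j; rewrite td' => /LN'P[t' t'P rec]; exists t' => //.
    by rewrite /= in szt; lia.
move=> S_next; exists u; rewrite /loop_invariant S_next; split=> //=.
- by rewrite /= in szt; split; lia.
- apply/setP => x; rewrite /LR' lr todoE !inE.
  by case: eqVneq => //= ->; apply/esym/negbTE; move: l_rest; rewrite inE.
- case: td => [->|td]; first by left.
  by right=> j j_rest; apply: td; rewrite todoE inE j_rest orbT.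
Qed.

(** Past the first loop, whose list contains all arms, an arm is processed only after a
    recommendation in the preceding loop; [2 * K] adds the lengths of the two loops. *)
Lemma recommended_of_draw t : (Tinit K + K < t <= T)%N ->
  exists2 t', (Tinit K < t' < t)%N && (t <= t' + 2 * K)%N &
    recommended t' (tr t).1.1.
Proof.
move=> /andP[tI tT]; have [|u [[ut szt] _ _ _ td]] := @loop_invariantP t; first lia.
have [|istar [rest [_ todoE _ _]]] := @S_step t; first lia.
rewrite todoE /= in szt td; case: td => [uE|td]; first lia.
have [|t' t'P rec] := td (tr t).1.1; first by rewrite inE eqxx.
by exists t' => //; lia.
Qed.

(** The bound by [T.+1] keeps the rest of the loop within the horizon, where the run follows the
    algorithm. *)
Lemma draw_of_todo a t : a \in todo (S t) -> (Tinit K < t)%N ->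
  (t + size (todo (S t)) <= T.+1)%N ->
  exists2 t', (t <= t' < t + size (todo (S t)))%N & (tr t').1.1 = a.
Proof.
have [n] := ubnP (size (todo (S t))); elim: n t => // n IH t lt_n a_todo tI tT.
have tT' : (Tinit K < t <= T)%N by case: (todo (S t)) a_todo tT => //= *; lia.
have [istar [rest [_ todoE _ next]]] := S_step tT'.
rewrite todoE /= in lt_n a_todo tT *; move: a_todo; rewrite inE => /predU1P[->|a_rest].
  by exists t => //; lia.
case: rest => [//|l' rest] in todoE next lt_n a_rest tT *.
have [||||t' t'P <-] := IH t.+1; rewrite ?next/= ?(ltnW tI)//=;
  try by rewrite /= in tT lt_n; lia.
by exists t' => //; rewrite next /= in t'P *; lia.
Qed.

Lemma draw_of_LN a t : a \in LN (S t) -> (Tinit K < t)%N -> (0 < size (todo (S t)))%N ->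
  (t + size (todo (S t)) + K <= T.+1)%N ->
  exists2 t', (t <= t' < t + size (todo (S t)) + K)%N & (tr t').1.1 = a.
Proof.
have [n] := ubnP (size (todo (S t))); elim: n t => // n IH t lt_n a_LN tI sz0 tT.
have tT' : (Tinit K < t <= T)%N by lia.
have [istar [rest [_ todoE _ next]]] := S_step tT'.
have K0 : (0 < K)%N by case: (a) => m; lia.
rewrite todoE /= in lt_n tT *; case: rest => [|l' rest] in todoE next lt_n tT *.
  have [_ sz' _ td' _] := loop_startP next.
  have [|||t' t'P <-] := @draw_of_todo a t.+1.
  - by rewrite td' inE a_LN.
  - exact: ltnW.
  - by rewrite /= in tT; lia.
  by exists t' => //=; lia.
have [|||||t' t'P <-] := IH t.+1; rewrite ?next/= ?inE ?a_LN ?(ltnW tI)//;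
  try by rewrite /= in tT lt_n; lia.
by exists t' => //; rewrite next /= in t'P *; lia.
Qed.

(** An arm still on the list is drawn in the current loop. Otherwise it is outside [LR], so the
    event puts it in [LN] and it is drawn in the next loop. The event is assumed for all minimizers
    because the run may pick any of them. *)
Lemma draw_of_recommended a t : (Tinit K < t)%N -> (t + 2 * K <= T.+1)%N ->
  (forall istar, is_istar R tr t istar -> eventJ tr t fK istar a) ->
  exists2 t', (t <= t' < t + 2 * K)%N & (tr t').1.1 = a.
Proof.
move=> tI tT J; have K0 : (0 < K)%N by case: (a) => m; lia.
have [|u [[ut szt] un lr _ _]] := @loop_invariantP t; first lia.
have [a_todo|a_todo] := boolP (a \in todo (S t)).
  have [//||t' t'P <-] := draw_of_todo a_todo; first lia.
  by exists t' => //; lia.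
have tT' : (Tinit K < t <= T)%N by lia.
have [istar [rest [ist todoE _ next]]] := S_step tT'.
have a_new : (a \notin LR (S t) :\ (tr t).1.1)%SET && eventJ tr t fK istar a.
  by rewrite J// andbT lr !inE (negbTE a_todo) andbF.
rewrite todoE /= in szt; case: rest => [|l' rest] in todoE next szt *.
  have [_ sz' _ td' _] := loop_startP next.
  have [|||t' t'P <-] := @draw_of_todo a t.+1.
  - by rewrite td' finset.in_setU inE a_new orbT.
  - exact: ltnW.
  - by lia.
  by exists t' => //=; lia.
have [||||t' t'P <-] := @draw_of_LN a t.+1.
- by rewrite next /= finset.in_setU inE a_new orbT.
- exact: ltnW.
- by rewrite next.
- by rewrite next /=; rewrite /= in szt; lia.
by exists t' => //; rewrite next /= in t'P; rewrite /= in szt; lia.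
Qed.

End Loops.

(** * Statistics along a trajectory *)

Section StatisticsFacts.
Context {R : realType} {K : nat} (tr : nat -> round K).
Implicit Types (t : nat) (i j w : 'I_K).

Lemma nwinsE t i j : (0 < t)%N -> nwins tr t i j = wins i j (hist tr t.-1).
Proof.
case: t => // t _; rewrite [t.+1.-1]/=; elim: t => [|t IH]; first by rewrite /nwins big_geq.
by rewrite histS wins_rcons -IH /nwins big_nat_recr.
Qed.

Lemma ncompE t i j : (0 < t)%N -> i != j ->
  ncomp tr t i j = (wins i j (hist tr t.-1) + wins j i (hist tr t.-1))%N.
Proof.
move=> t0 ij; rewrite -!nwinsE// /nwins /ncomp -big_split /=.
by apply: eq_bigr => s _; rewrite preferredD.
Qed.

Lemma ncomp_sym t i j : ncomp tr t i j = ncomp tr t j i.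
Proof. by apply: eq_bigr => s _; rewrite compared_sym. Qed.

Lemma ncompD t i j : (0 < t)%N -> i != j ->
  ncomp tr t i j = (nwins tr t i j + nwins tr t j i)%N.
Proof. by move=> t0 ij; rewrite ncompE// !nwinsE. Qed.

Lemma muhat_neq t i j : i != j -> (0 < ncomp tr t i j)%N ->
  muhat R tr t i j = (nwins tr t i j)%:R / (ncomp tr t i j)%:R.
Proof. by move=> ij n0; rewrite /muhat (negbTE ij) eqn0Ngt n0. Qed.

Lemma muhat_01 t i j : (0 < t)%N -> 0 <= muhat R tr t i j <= 1.
Proof.
move=> t0; rewrite /muhat; case: ifPn => [_|]; first by lra.
rewrite negb_or => /andP[ij n0]; rewrite -lt0n in n0; rewrite divr_ge0//=.
by rewrite ler_pdivrMr ?ltr0n// mul1r ler_nat ncompD// leq_addr.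
Qed.

Lemma muhat_le_half t i j : (0 < t)%N -> i != j ->
  (muhat R tr t i j <= 1 / 2) = (nwins tr t i j <= nwins tr t j i)%N.
Proof.
move=> t0 ij; have [n0|n0] := posnP (ncomp tr t i j).
  (* An undrawn pair has [muhat = 1 / 2] and no wins, so both sides hold. *)
  rewrite /muhat n0 eqxx orbT lexx; move: n0; rewrite ncompD//; lia.
rewrite muhat_neq// ler_pdivrMr ?ltr0n// ncompD//.
rewrite natrD -(ler_nat R); apply/idP/idP; lra.
Qed.

Lemma mem_opponents t i j : (0 < t)%N -> i != j ->
  (j \in opponents R tr t i) = (nwins tr t i j <= nwins tr t j i)%N.
Proof. by move=> t0 ij; rewrite inE eq_sym ij muhat_le_half. Qed.

Lemma empdiv_term_ge0 t i j : (0 < t)%N ->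
  0 <= (ncomp tr t i j)%:R * kl (muhat R tr t i j) (1 / 2).
Proof. by move=> t0; rewrite mulr_ge0// kl_ge0 ?muhat_01// half_in01. Qed.

Lemma empdiv_ge0 t i : (0 < t)%N -> 0 <= empdiv R tr t i.
Proof. by move=> t0; apply: sumr_ge0 => j _; apply: empdiv_term_ge0. Qed.

Lemma empdiv_low_divergence t w : (0 < t)%N ->
  empdiv R tr t w = low_divergence w (hist tr t.-1).
Proof.
move=> t0; rewrite /empdiv /low_divergence; apply: eq_big => [j|j].
  rewrite inE; have [//|jw] := eqVneq j w; rewrite muhat_le_half// 1?eq_sym//.
  by rewrite !nwinsE.
rewrite inE => /andP[jw _]; rewrite -ncompE 1?eq_sym//.
have [->|n0] := posnP (ncomp tr t w j); first by rewrite !mul0r.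
by rewrite muhat_neq 1?eq_sym// nwinsE.
Qed.

(** An arm without opponents has beaten every other arm more often than it lost, so it is an
    opponent of each of them and contributes a term to their divergence. This makes it the unique
    minimizer and limits how long [i] is recommended. *)
Lemma empdiv_ge_term t i w : (0 < t)%N -> i != w -> opponents R tr t w = finset.set0 ->
  [/\ w \in opponents R tr t i, (0 < ncomp tr t w i)%N,
    muhat R tr t w i != 1 / 2 &
    (ncomp tr t w i)%:R * kl (muhat R tr t w i) (1 / 2) <= empdiv R tr t i].
Proof.
move=> t0 iw opp0; have wi : w != i by rewrite eq_sym.
have lt : (nwins tr t i w < nwins tr t w i)%N.
  by have := finset.in_set0 i; rewrite -opp0 mem_opponents//; lia.
have n0 : (0 < ncomp tr t w i)%N by rewrite ncompD//; lia.
have w_opp : w \in opponents R tr t i by rewrite mem_opponents// ltnW.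
split=> //.
  by rewrite eq_le negb_and muhat_le_half// -ltnNge lt.
rewrite /empdiv (bigD1 w)//= ncomp_sym.
have -> : kl (muhat R tr t w i) (1 / 2) = kl (muhat R tr t i w) (1 / 2) :> R.
  rewrite -[RHS]kl_half_sym !muhat_neq// 1?ncomp_sym//; congr kl.
  rewrite [ncomp tr t i w]ncomp_sym in n0 *; rewrite ncompD// natrD.
  have : (nwins tr t w i)%:R + (nwins tr t i w)%:R != 0 :> R.
    by rewrite -natrD pnatr_eq0; lia.
  by move=> ?; field.
by rewrite lerDl; apply: sumr_ge0 => j _; apply: empdiv_term_ge0.
Qed.

Lemma empdiv_eq0 t w : opponents R tr t w = finset.set0 -> empdiv R tr t w = 0.
Proof. by move=> opp0; rewrite /empdiv opp0 big_set0. Qed.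

Lemma istar_eq t w istar : (0 < t)%N -> opponents R tr t w = finset.set0 ->
  is_istar R tr t istar -> istar = w.
Proof.
move=> t0 opp0 ist; apply/eqP; apply: contraT => sw.
have [_ n0 half_neq le] := empdiv_ge_term t0 sw opp0.
have := le_trans le (ist w); rewrite empdiv_eq0// leNgt mulr_gt0 ?ltr0n//.
by rewrite kl_gt0 ?muhat_01// half_in01.
Qed.

(** The first draw of the pair from [t] on still sees the counts of time [t]. *)
Lemma unchanged_or_compared t u i j : i != j -> (0 < t <= u)%N ->
  (exists2 v, (t <= v < u)%N & [/\ compared (tr v) i j,
     nwins tr v i j = nwins tr t i j & nwins tr v j i = nwins tr t j i]) \/
  (nwins tr u i j = nwins tr t i j /\ nwins tr u j i = nwins tr t j i).
Proof.
move=> ij /andP[t0]; elim: u => [|u IH]; first by case: t t0.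
rewrite leq_eqVlt => /predU1P[->|]; first by right.
rewrite ltnS => tu; case: (IH tu) => [[v vu H]|[e1 e2]].
  by left; exists v => //; lia.
have [cmp|ncmp] := boolP (compared (tr u) i j).
  by left; exists u => //; lia.
right; rewrite -e1 -e2 /nwins !big_nat_recr ?(leq_trans t0)//=.
by rewrite !preferredN ?addn0// compared_sym.
Qed.

Lemma ncomp_window t u i j : (0 < t <= u)%N ->
  (ncomp tr u i j <= ncomp tr t i j + (u - t))%N.
Proof.
move=> /andP[t0 tu]; rewrite /ncomp (big_cat_nat t0 tu)/= leq_add2l.
apply: (@leq_trans (\sum_(t <= s < u) 1)); last by rewrite sum_nat_const_nat muln1.
by apply: leq_sum => s _; case: compared.
Qed.

Lemma sum_compared_le t i j (b : R) : 0 <= b ->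
  \sum_(1 <= s < t.+1) (compared (tr s) i j && ((ncomp tr s i j)%:R < b)%R)%:R <=
  b + 1.
Proof.
pose F s : R := (compared (tr s) i j && ((ncomp tr s i j)%:R < b)%R)%:R.
(* The second bound carries the induction: a newly counted draw finds the sum at most [ncomp], which
   is below [b]. *)
move=> b0; suff : \sum_(1 <= s < t.+1) F s <= b + 1 /\
  \sum_(1 <= s < t.+1) F s <= (ncomp tr t.+1 i j)%:R :> R by case.
rewrite {}/F; elim: t => [|t [IH1 IH2]]; first by rewrite !big_geq// ler0n; split=> //; lra.
rewrite big_nat_recr//=.
have -> : ncomp tr t.+2 i j = (ncomp tr t.+1 i j + compared (tr t.+1) i j)%N.
  by rewrite {1}/ncomp big_nat_recr.
rewrite natrD; case: compared => /=; last by rewrite !addr0.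
have [lt|_] := boolP (_ < b); rewrite ?mulr1n ?mulr0n; split; lra.
Qed.

End StatisticsFacts.

(** * Sums over sliding windows of rounds *)

Section Windows.
Context {R : realType}.

(** Each round lies in at most [W] windows, and windows that overrun [T] collect nothing there. *)
Lemma sum_window_forward (f : nat -> R) T W : (forall t, 0 <= f t) ->
  (forall t, (T < t)%N -> f t = 0) ->
  \sum_(1 <= t < T.+1) \sum_(u < W) f (t + u)%N <= W%:R * \sum_(1 <= t < T.+1) f t.
Proof.
move=> f0 fT; rewrite exchange_big /= -[W in leRHS]card_ord -sum1_card natr_sum mulr_suml.
apply: ler_sum => -[u _] _ /=; rewrite mul1r.
elim: u f f0 fT => [|u IH] f f0 fT; first by under eq_bigr do rewrite addn0.
under eq_bigr do rewrite addnS -addSn.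
apply: (le_trans (IH (f \o succn) _ _)) => //= [t tT|]; first by rewrite fT// ltnW.
have := big_nat_recl T.+1 1 f (isT : (1 <= T.+1)%N) (op := +%R) (idx := 0).
by rewrite [LHS]big_nat_recr//= fT// addr0 => ->; rewrite lerDr.
Qed.

(** Truncated subtraction makes early windows hit round 0 repeatedly, where [f] vanishes. *)
Lemma sum_window_backward (f : nat -> R) T W : (forall t, 0 <= f t) -> f 0%N = 0 ->
  \sum_(1 <= t < T.+1) \sum_(u < W) f (t - u)%N <= W%:R * \sum_(1 <= t < T.+1) f t.
Proof.
move=> f0 f_0; rewrite exchange_big /= -[W in leRHS]card_ord -sum1_card natr_sum mulr_suml.
apply: ler_sum => -[u _] _ /=; rewrite mul1r.
elim: u f f0 f_0 => [|u IH] f f0 f_0; first by under eq_bigr do rewrite subn0.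
under eq_bigr do rewrite subnS.
apply: (le_trans (IH (f \o predn) _ _)) => //=.
rewrite big_add1 /=; have := big_ltn (ltn0Sn T) (F := f) (op := +%R) (idx := 0).
by rewrite f_0 add0r => <-; rewrite big_nat_recr//= lerDl.
Qed.

End Windows.

Lemma ncomp_le_pred (K : nat) (tr : nat -> round K) t i j : (0 < t)%N ->
  (ncomp tr t i j <= t.-1)%N.
Proof.
move=> t0; have := @ncomp_window K tr 1 t i j t0.
by rewrite {2}/ncomp big_geq// add0n subn1.
Qed.

Lemma gap_ge0 (R : realType) (K : nat) (mu : 'M[R]_K) (w i : 'I_K) :
  preference_matrix mu -> condorcet_winner mu w -> 0 <= gap mu w i.
Proof.
move=> [_ _ mu_half] hw; rewrite /gap subr_ge0.
by have [->|iw] := eqVneq i w; [rewrite mu_half|exact/ltW/hw].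
Qed.

(** * Regret of a trajectory bounded through its history *)

Section HistoryBound.
Context {R : realType} {K : nat} (r0 : round K) (w : 'I_K).
Implicit Types h : seq (round K).

Definition visits s (z : R) h : R :=
  accum r0 (fun h r => (low_visit w s z h r)%:R) h.

Definition divergences h : R :=
  accum r0 (fun h _ => (@low_divergence_exceeds R K w h)%:R) h.

(** Bounds the number of rounds in which [w] has an opponent: rounds of large divergence, and
    [2 * K] rounds for each low draw of a pair [{w, s}] and for the end of the horizon. *)
Definition contest_bound h : R :=
  divergences h + (2 * K)%:R * (1 + \sum_(s | s != w) visits s (1 / 2) h).

(** The three terms pay for the first rounds, for the rounds in which [w] has an opponent, and for
    the draws of each [i] while [w] has none. *)
Definition history_bound (mu : 'M[R]_K) (y B : 'I_K -> R) h : R :=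
  (Tinit K + 2 * K)%:R + contest_bound h +
  \sum_(i | i != w) gap mu w i / 2 *
    (B i + (2 * K)%:R + 1 + (2 * K).+1%:R * (contest_bound h + visits i (y i) h)).

End HistoryBound.

Section RegretBound.
Context {R : realType} {K : nat} {mu : 'M[R]_K} {w : 'I_K} {fK : R} {T : nat}.
Context {tr : nat -> round K} {r0 : round K} {y B : 'I_K -> R}.
Hypothesis hmu : preference_matrix mu.
Hypothesis hw : condorcet_winner mu w.
Hypothesis fK0 : 0 <= fK.
Hypothesis htr : rmed1_trajectory fK T tr.
Hypothesis B0 : forall i, 0 <= B i.
(** [B i] is the leading number of draws of [{w, i}]. After that many, a divergence within the
    recommendation threshold forces a win rate of [w] of at most [y i]. *)
Hypothesis yB : forall i, i != w -> forall k l, (0 < k + l <= T)%N ->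
  B i <= (k + l)%:R ->
  (k + l)%:R * kl (k%:R / (k + l)%:R) (1 / 2) <= ln T%:R + fK ->
  k%:R <= y i * (k + l)%:R.

Let contested t : bool := (Tinit K < t <= T)%N && (opponents R tr t w != finset.set0).

Let low s (z : R) t : bool := (0 < t <= T)%N && low_visit w s z (hist tr t.-1) (tr t).

Let exceeds t : bool := (0 < t <= T)%N && @low_divergence_exceeds R K w (hist tr t.-1).

Let draws i t : bool := [&& (Tinit K + 2 * K < t <= T)%N,
  opponents R tr t w == finset.set0 & (tr t).1 == (i, w)].

Let ler_indic (b c : bool) : (b -> c) -> b%:R <= c%:R :> R.
Proof. by rewrite ler_nat; case: b; case: c => // H; have := H isT. Qed.

Let sum_window_ge (f : nat -> R) W t v : (forall t, 0 <= f t) -> (t <= v < t + W)%N ->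
  f v <= \sum_(u < W) f (t + u)%N.
Proof.
move=> f0 tv; have vW : (v - t < W)%N by lia.
rewrite (bigD1 (Ordinal vW))//= subnKC ?lerDl; last lia.
exact: sumr_ge0.
Qed.

Let sum_window_back_ge (f : nat -> R) W t v : (forall t, 0 <= f t) -> (v <= t < v + W)%N ->
  f v <= \sum_(u < W) f (t - u)%N.
Proof.
move=> f0 tv; have vW : (t - v < W)%N by lia.
rewrite (bigD1 (Ordinal vW))//= subKn ?lerDl; last lia.
exact: sumr_ge0.
Qed.

Let lowP s z t : s != w -> (0 < t <= T)%N -> compared (tr t) w s ->
  (nwins tr t w s)%:R <= z * (ncomp tr t w s)%:R -> low s z t.
Proof.
move=> sw tT cmp; have ws : w != s by rewrite eq_sym.
have t0 : (0 < t)%N by case/andP: tT.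
by rewrite /low /low_visit tT cmp ncompE// nwinsE.
Qed.

Let low_halfP s t : s != w -> (0 < t <= T)%N -> compared (tr t) w s ->
  (nwins tr t w s <= nwins tr t s w)%N -> low s (1 / 2) t.
Proof.
move=> sw tT cmp le; apply: lowP => //; have ws : w != s by rewrite eq_sym.
have t0 : (0 < t)%N by case/andP: tT.
by rewrite ncompD// natrD; move: le; rewrite -(ler_nat R); lra.
Qed.

(** If the divergence of [w] is small, [w] is recommended whatever the minimizer, and hence drawn at
    some [v] within two loops. If [w] still has an opponent at [v], the choice of [m(v)] falls on
    one. If not, an opponent [s] at [t] has lost this status, which takes a draw of [{w, s}] while
    its counts were those of [t]. *)
Let low_draw_of_contested t : contested t -> ~~ exceeds t -> (t + 2 * K <= T.+1)%N ->
  exists2 v, (t <= v < t + 2 * K)%N & exists2 s, s != w & low s (1 / 2) v.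
Proof.
move=> /andP[/andP[tI tT] opp] ex tK; have t0 : (0 < t)%N by lia.
have [_ [S [S_start S_step]]] := htr.
have J istar : is_istar R tr t istar -> eventJ tr t fK istar w.
  move=> _; rewrite /eventJ; have := @empdiv_ge0 R K tr t istar t0.
  move: ex; rewrite /exceeds t0 tT /low_divergence_exceeds size_hist prednK//= -leNgt.
  rewrite -empdiv_low_divergence// => le ge.
  by rewrite lerBlDr (le_trans le)// -addrA lerDl addr_ge0.
have [v tv lv] := draw_of_recommended S_start S_step tI tK J.
have vT : (0 < v <= T)%N by lia.
have v0 : (0 < v)%N by lia.
have [opp0|opp_v] := eqVneq (opponents R tr v w) finset.set0.
  have [s s_opp] := set0Pn _ opp.
  have sw : s != w by move: s_opp; rewrite inE => /andP[].
  have ws : w != s by rewrite eq_sym.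
  rewrite mem_opponents// in s_opp.
  have [|[x xv [cmp e1 e2]]|[e1 e2]] := @unchanged_or_compared _ tr t v w s ws.
  - by lia.
  - by exists x; [lia|exists s => //; apply: low_halfP => //; [lia|rewrite e1 e2]].
  - by have := finset.in_set0 s; rewrite -opp0 mem_opponents// e1 e2 s_opp.
exists v; first lia.
have [|istar [rest [_ _ + _]]] := S_step v; first lia.
rewrite lv; set m := (tr v).1.2; have cmp : compared (tr v) w m.
  by rewrite /compared /m -lv -surjective_pairing eqxx.
have finish : m != w -> muhat R tr v w m <= 1 / 2 -> exists2 s, s != w & low s (1 / 2) v.
  move=> mw le; exists m => //; apply: low_halfP => //.
  by rewrite -(@muhat_le_half R)// eq_sym.
(* Either [m] is a minimizer lying among the opponents, or it has the least [muhat], at most that of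
   any opponent. *)
rewrite /valid_opponent (negbTE opp_v) orbF; case: ifPn => [ist mE|_ [mw min]].
  by apply: finish; move: ist; rewrite -mE inE => /andP[].
apply: finish => //; have [s] := set0Pn _ opp_v.
by rewrite inE => /andP[sw]; apply: le_trans; apply: min.
Qed.

(** The indicator of [t + u == T] pays for rounds whose window overruns the horizon. *)
Let contested_le t : (contested t)%:R <= (exceeds t)%:R +
  \sum_(u < 2 * K) ((t + u == T)%:R + \sum_(s | s != w) (low s (1 / 2) (t + u))%:R) :> R.
Proof.
pose f v : R := (v == T)%:R + \sum_(s | s != w) (low s (1 / 2) v)%:R.
have f0 v : 0 <= f v by rewrite addr_ge0// sumr_ge0.
have sum0 : 0 <= \sum_(u < 2 * K) f (t + u)%N by apply: sumr_ge0.
rewrite -/(f _); have [ct|_] := boolP (contested t); last by rewrite addr_ge0.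
have [_|ex] := boolP (exceeds t); first by rewrite lerDl.
rewrite add0r; have [tK|tK] := leqP (t + 2 * K) T.+1; last first.
  have [/andP[tI tT] _] := andP ct.
  apply: le_trans (sum_window_ge (v := T) f0 _); last lia.
  by rewrite /f eqxx lerDl sumr_ge0.
have [v tv [s sw lo]] := low_draw_of_contested ct ex tK.
apply: le_trans (sum_window_ge f0 tv).
by rewrite /f (bigD1 s)//= lo addrCA lerDl addr_ge0// sumr_ge0.
Qed.

(** The draw stems from a recommendation of [i] at some [v] at most [2 * K] rounds earlier. Either
    [w] had an opponent at [v]; or [{w, i}] had fewer than [B i] draws then, hence fewer than
    [B i + 2 * K] now; or the win rate at [v] was at most [y i], and the first draw of the pair from
    [v] on, at the latest at [t], is low. *)
Let draws_le i t : i != w -> (draws i t)%:R <=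
  (compared (tr t) w i && ((ncomp tr t w i)%:R < B i + (2 * K)%:R)%R)%:R +
  \sum_(u < (2 * K).+1) ((contested (t - u))%:R + (low i (y i) (t - u))%:R) :> R.
Proof.
move=> iw; pose f v : R := (contested v)%:R + (low i (y i) v)%:R.
have f0 v : 0 <= f v by rewrite addr_ge0.
have sum0 : 0 <= \sum_(u < (2 * K).+1) f (t - u)%N by apply: sumr_ge0.
rewrite -/(f _).
have [/and3P[tT /eqP opp /eqP drawn]|_] := boolP (draws i t); last by rewrite addr_ge0.
have wi : w != i by rewrite eq_sym.
have cmp : compared (tr t) w i by rewrite /compared drawn eqxx orbT.
have [_ [S [S_start S_step]]] := htr.
have [|v vt [istar [ist J]]] := recommended_of_draw S_start S_step (t := t); first lia.
have v0 : (0 < v)%N by lia.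
have window : (v <= t < v + (2 * K).+1)%N by lia.
have [opp0|opp_v] := eqVneq (opponents R tr v w) finset.set0; last first.
  have ct : contested v by rewrite /contested opp_v andbT; lia.
  apply: ler_wpDl => //; apply: le_trans (sum_window_back_ge f0 window).
  by rewrite /f ct lerDl.
have [_ n0 _ le] := @empdiv_ge_term R K tr v i w v0 iw opp0.
rewrite drawn /= in J; have {ist}istE := istar_eq v0 opp0 ist.
have Jle : empdiv R tr v i <= ln T%:R + fK.
  move: J; rewrite /eventJ istE (empdiv_eq0 opp0) subr0 => /le_trans; apply.
  by rewrite lerD2r ler_ln ?posrE ?ltr0n ?ler_nat//; lia.
have [lt|ge] := ltP (ncomp tr v w i)%:R (B i).
  have lt' : (ncomp tr t w i)%:R < B i + (2 * K)%:R.
    have le2 : ((ncomp tr t w i)%:R <= (ncomp tr v w i)%:R + (2 * K)%:R :> R).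
      rewrite -natrD ler_nat; apply: leq_trans (@ncomp_window K tr v t w i _) _;
        clear -v0 vt; lia.
    by apply: le_lt_trans le2 _; rewrite ltrD2r.
  by rewrite cmp lt' lerDl.
have lowv : (nwins tr v w i)%:R <= y i * (ncomp tr v w i)%:R.
  have nD := @ncompD K tr v w i v0 wi; rewrite nD in n0 ge le *.
  apply: yB => //; first by rewrite n0 -nD; apply: leq_trans (ncomp_le_pred tr w i v0) _;
    clear -vt tT; lia.
  by rewrite -nD -muhat_neq// ?nD//; apply: le_trans le Jle.
apply: ler_wpDl => //.
have vt0 : (0 < v <= t)%N by clear -v0 vt; lia.
have t0 : (0 < t)%N by clear -vt0; lia.
have [[x xv [cmpx e1 e2]]|[e1 e2]] := @unchanged_or_compared _ tr v t w i wi vt0.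
- have x0 : (0 < x)%N by clear -vt0 xv; lia.
  have lo : low i (y i) x.
    apply: lowP => //; first by clear -x0 xv tT; lia.
    by rewrite ncompD// e1 e2 -ncompD.
  have xw : (x <= t < x + (2 * K).+1)%N by clear -xv vt; lia.
  by apply: le_trans (sum_window_back_ge f0 xw); rewrite /f lo lerDr.
- have lo : low i (y i) t.
    apply: lowP => //; first by clear -t0 tT; lia.
    by rewrite ncompD// e1 e2 -ncompD.
  have tw : (t <= t < t + (2 * K).+1)%N by clear; lia.
  by apply: le_trans (sum_window_back_ge f0 tw); rewrite /f lo lerDr.
Qed.

Let sum_indicator_le n : \sum_(1 <= t < T.+1) (t <= n)%N%:R <= n%:R :> R.
Proof.
rewrite -natr_sum ler_nat; suff -> : (\sum_(1 <= t < T.+1) (t <= n))%N = minn T n.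
  exact: geq_minr.
by elim: T => [|k IH]; [rewrite big_geq// min0n|rewrite big_nat_recr//= IH; lia].
Qed.

Let sum_eq_T_le : \sum_(1 <= t < T.+1) (t == T)%:R <= 1 :> R.
Proof.
rewrite -natr_sum lern1; case: T => [|k]; first by rewrite big_geq.
rewrite big_nat_recr//= eqxx big_nat big1// => t tk.
by case: eqP => // e; move: tk; rewrite e ltnn andbF.
Qed.

Let sum_low_le s z : \sum_(1 <= t < T.+1) (low s z t)%:R <= visits r0 w s z (hist tr T).
Proof.
rewrite /visits accum_hist; apply: ler_sum => t _; apply: ler_indic.
by case/andP.
Qed.

Let sum_contested_le :
  \sum_(1 <= t < T.+1) (contested t)%:R <= contest_bound r0 w (hist tr T) :> R.
Proof.
apply: le_trans (ler_sum _ (fun t _ => contested_le t)) _.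
rewrite big_split /=; apply: lerD.
  rewrite /divergences accum_hist; apply: ler_sum => t _; apply: ler_indic.
  by case/andP.
apply: le_trans (sum_window_forward _ (f := fun v : nat => (v == T)%:R +
  \sum_(s | s != w) (low s (1 / 2) v)%:R) _ _) _.
- by move=> t; rewrite addr_ge0// sumr_ge0.
- move=> t Tt; rewrite gtn_eqF// add0r big1// => s _.
  by rewrite /low [(t <= T)%N]leqNgt Tt andbF.
apply: ler_wpM2l => //; rewrite big_split /=; apply: lerD; first exact: sum_eq_T_le.
by rewrite exchange_big /=; apply: ler_sum => s _; apply: sum_low_le.
Qed.

Let sum_draws_le i : i != w -> \sum_(1 <= t < T.+1) (draws i t)%:R <=
  B i + (2 * K)%:R + 1 + (2 * K).+1%:R *
    (\sum_(1 <= t < T.+1) (contested t)%:R + visits r0 w i (y i) (hist tr T)) :> R.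
Proof.
move=> iw; apply: le_trans (ler_sum _ (fun t _ => draws_le t iw)) _.
rewrite big_split /=; apply: lerD; first by apply: sum_compared_le; rewrite addr_ge0.
apply: le_trans (sum_window_backward _ _ (f := fun v : nat => (contested v)%:R +
  (low i (y i) v)%:R) _ _) _.
- by move=> t; rewrite addr_ge0.
- by rewrite /contested /low /= addr0.
by apply: ler_wpM2l => //; rewrite big_split /= lerD2l sum_low_le.
Qed.

Let gap_w j : 0 <= gap mu w j <= 1 / 2.
Proof.
have [mu01 _ mu_half] := hmu; have /andP[_ m1] := mu01 w j; rewrite /gap.
have [->|jw] := eqVneq j w; first by rewrite mu_half subrr; lra.
by have := hw jw; lra.
Qed.

(** When [w] has no opponent it is the only minimizer and an opponent of every other arm, so the
    rule always gives [m(t) = w]: the regret is half the gap of [l(t)]. *)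
Let round_regret_le t : (0 < t <= T)%N ->
  (gap mu w (tr t).1.1 + gap mu w (tr t).1.2) / 2 <=
  (t <= Tinit K + 2 * K)%N%:R + (contested t)%:R +
  \sum_(i | i != w) gap mu w i / 2 * (draws i t)%:R :> R.
Proof.
move=> /andP[t0 tT]; have [_ _ mu_half] := hmu.
have avg1 : (gap mu w (tr t).1.1 + gap mu w (tr t).1.2) / 2 <= 1.
  have /andP[_ ?] := gap_w (tr t).1.1; have /andP[_ ?] := gap_w (tr t).1.2.
  by rewrite ler_pdivrMr//; lra.
have sum0 : 0 <= \sum_(i | i != w) gap mu w i / 2 * (draws i t)%:R.
  by apply: sumr_ge0 => i _; rewrite mulr_ge0//; have := gap_w i; lra.
have [tK|tK] := leqP t (Tinit K + 2 * K).
  by rewrite -[leRHS]addrA; apply: (le_trans avg1); rewrite lerDl addr_ge0.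
have tI : (Tinit K < t <= T)%N by clear -tK tT; lia.
have [opp0|opp] := eqVneq (opponents R tr t w) finset.set0; last first.
  have -> : contested t by rewrite /contested opp tI.
  by apply: (le_trans avg1); rewrite mulr0n add0r lerDl.
have [_ [S [_ S_step]]] := htr.
have [istar [rest [ist _ + _]]] := S_step t tI.
rewrite (istar_eq t0 opp0 ist) /valid_opponent.
have [lw|lw] := eqVneq (tr t).1.1 w.
  rewrite lw opp0 eqxx orbT => ->; rewrite /gap mu_half subrr addr0 mul0r.
  by rewrite !addr_ge0.
have [w_opp _ _ _] := @empdiv_ge_term R K tr t (tr t).1.1 w t0 lw opp0.
rewrite w_opp /= => mE.
have -> : gap mu w (tr t).1.2 = 0 by rewrite mE /gap mu_half subrr.
have dr : draws (tr t).1.1 t.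
  by rewrite /draws tK tT opp0 eqxx -mE /= -surjective_pairing.
rewrite addr0 (bigD1 (tr t).1.1)//= dr mulr1 addrCA lerDl.
rewrite !addr_ge0//; apply: sumr_ge0 => i _; rewrite mulr_ge0//.
by have := gap_w i; lra.
Qed.

Lemma regret_le_history_bound :
  regret mu w T tr <= history_bound r0 w mu y B (hist tr T).
Proof.
rewrite /regret.
apply: (@le_trans _ _ (\sum_(1 <= t < T.+1) (
    (t <= Tinit K + 2 * K)%N%:R + (contested t)%:R +
    \sum_(i | i != w) gap mu w i / 2 * (draws i t)%:R))).
  by rewrite !big_nat; apply: ler_sum => t /round_regret_le.
rewrite !big_split /= exchange_big /=; apply: lerD; first apply: lerD.
- exact: sum_indicator_le.
- exact: sum_contested_le.
apply: ler_sum => i iw; rewrite -mulr_sumr; apply: ler_wpM2l.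
  by have := gap_w i; lra.
apply: le_trans (sum_draws_le iw) _; rewrite lerD2l; apply: ler_wpM2l => //.
by rewrite lerD2r sum_contested_le.
Qed.

End RegretBound.

(** * Expected regret *)

Section ExpectHistoryBound.
Context {R : realType} {K : nat} {mu : 'M[R]_K} {w : 'I_K}.
Context {d : measure_display} {Omega : measurableType d}.
Context {P : probability Omega R} {T : nat} {Z : nat -> Omega -> round K}.
Context {r0 : round K}.
Hypothesis hmu : preference_matrix mu.
Hypothesis hw : condorcet_winner mu w.
Hypothesis mZ : discrete_process T Z.
Hypothesis bZ : bernoulli_feedback P T Z mu.

Let E F := @expect R K d Omega P Z T F.

Let expectD F G : E (fun h => F h + G h) = E F + E G.
Proof. by rewrite /E /expect -big_split; apply: eq_bigr => h _; rewrite mulrDr. Qed.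

Let expectZ a F : E (fun h => a * F h) = a * E F.
Proof. by rewrite /E /expect mulr_sumr; apply: eq_bigr => h _; rewrite mulrCA. Qed.

Let expect_sum (p : pred 'I_K) F :
  E (fun h => \sum_(i | p i) F i h) = \sum_(i | p i) E (F i).
Proof.
by rewrite /E /expect exchange_big; apply: eq_bigr => h _; rewrite mulr_sumr.
Qed.

Let expect_cst a : E (fun=> a) <= a.
Proof.
by apply: (expect_potential (r0 := r0) mZ bZ) => _ x y; rewrite -mulrDl addrC subrK mul1r.
Qed.

Lemma expect_history_bound_le y B CD V CB :
  CB = CD + (2 * K)%:R * (1 + \sum_(s | s != w) 8 / (mu w s - 1 / 2) ^+ 2) ->
  E (divergences r0 w) <= CD ->
  (forall i, i != w -> E (visits r0 w i (y i)) <= V i) ->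
  E (history_bound r0 w mu y B) <= (Tinit K + 2 * K)%:R + CB +
    \sum_(i | i != w) gap mu w i / 2 *
      (B i + (2 * K)%:R + 1 + (2 * K).+1%:R * (CB + V i)).
Proof.
move=> CBE ECD EV; have half s : s != w ->
    E (visits r0 w s (1 / 2)) <= 8 / (mu w s - 1 / 2) ^+ 2.
  move=> sw; apply: (expect_visits_quadratic mZ bZ hmu); first by rewrite eq_sym.
  by rewrite hw// andbT; lra.
have ECB : E (contest_bound r0 w) <= CB.
  rewrite CBE /contest_bound expectD; apply: lerD => //.
  rewrite expectZ; apply: ler_wpM2l => //.
  rewrite expectD; apply: lerD; first exact: expect_cst.
  by rewrite expect_sum; apply: ler_sum.
rewrite /history_bound expectD; apply: lerD.
  by rewrite expectD; apply: lerD; [exact: expect_cst|exact: ECB].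
rewrite expect_sum; apply: ler_sum => i iw; rewrite expectZ; apply: ler_wpM2l.
  by rewrite divr_ge0// gap_ge0.
rewrite expectD; apply: lerD; first exact: expect_cst.
rewrite expectZ; apply: ler_wpM2l => //.
by rewrite expectD; apply: lerD; [exact: ECB|exact: EV].
Qed.

End ExpectHistoryBound.

(** With nonnegative gaps the regret is a nonnegative function of the history, so its expectation is
    a finite sum; the comparison with [G] is then made outcome by outcome. *)
Lemma regret_le_expect (R : realType) (K : nat) (mu : 'M[R]_K) (w : 'I_K)
    (T : nat) (d : measure_display) (Omega : measurableType d)
    (P : probability Omega R) (Z : nat -> Omega -> round K)
    (G : seq (round K) -> R) :
  preference_matrix mu -> condorcet_winner mu w -> discrete_process T Z ->
  (forall o, regret mu w T (fun t => Z t o) <= G (hist (Z^~ o) T)) ->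
  ('E_P[fun o => regret mu w T (fun t => Z t o)] <= (@expect R K d Omega P Z T G)%:E)%E.
Proof.
move=> hmu hw mZ leG.
have gap0 i := gap_ge0 i hmu hw.
pose c (_ : seq (round K)) (r : round K) := (gap mu w r.1.1 + gap mu w r.1.2) / 2.
have -> : (fun o => regret mu w T (fun t => Z t o)) =
    (fun o => accum (w, w, true) c (hist (Z^~ o) T)).
  by apply/funext => o; rewrite accum_hist.
rewrite expectation_hist// => [|h]; last first.
  by apply: sumr_ge0 => s _; rewrite divr_ge0// addr_ge0.
by rewrite lee_fin; apply: ler_expect => o; rewrite accum_hist; apply: leG.
Qed.

(** * Thresholds on draws and win rates *)

Section Thresholds.
Context {R : realType}.

(** The tangent at [m > 1 / 2] has positive slope, so a deficit in divergence becomes a proportional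
    deficit in [x]. *)
Lemma kl_half_tangent_le (x m : R) : 0 <= x <= 1 -> 1 / 2 < m < 1 ->
  x <= m - (kl m (1 / 2) - kl x (1 / 2)) / ln (m / (1 - m)).
Proof.
move=> x01 /andP[m2 m1]; have m01 : 0 < m < 1 by rewrite m1 andbT; lra.
have l0 : 0 < ln (m / (1 - m)).
  by rewrite ln_gt0// ltr_pdivlMr ?subr_gt0// mul1r; lra.
have := kl_half_tangent x01 m01.
rewrite lerBrDr -lerBrDl ler_pdivrMr//; lra.
Qed.

(** The divergence vanishes at [1 / 2], so the tangent inequality there bounds the quotient by
    [m - 1 / 2]. This keeps the win-rate thresholds nonnegative. *)
Lemma kl_half_slope_le (m : R) : 1 / 2 < m < 1 ->
  0 < kl m (1 / 2) / ln (m / (1 - m)) <= 1 / 2.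
Proof.
move=> m21; have /andP[m2 m1] := m21; have m01 : 0 < m < 1 by rewrite m1 andbT; lra.
have l0 : 0 < ln (m / (1 - m)).
  by rewrite ln_gt0// ltr_pdivlMr ?subr_gt0// mul1r; lra.
have k0 : 0 < kl m (1 / 2).
  by apply: kl_gt0; rewrite ?half_in01//; [lra|rewrite gt_eqF].
rewrite divr_gt0//=.
have h01 : 0 <= (1 / 2 : R) <= 1 by lra.
have := kl_half_tangent_le h01 m21; have -> : kl (1 / 2) (1 / 2) = 0 :> R.
  have -> : (1 / 2 : R) = 1 - 1 / 2 by lra.
  rewrite /kl; have -> : 1 - (1 - 1 / 2) = 1 - 1 / 2 :> R by lra.
  by rewrite divff ?ln1 ?mulr0 ?addr0//; lra.
rewrite subr0; lra.
Qed.

(** The hypotheses bound [v] by [D] times [(L + f) / ((1 + delta) * L + f)], and [f <= L] bounds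
    this ratio by [1 - delta / 3]. *)
Lemma kl_threshold (L f delta D v n : R) : 0 < delta < 1 -> 0 <= f <= L -> 0 < n ->
  0 < D -> ((1 + delta) * L + f) / D <= n -> n * v <= L + f -> v <= (1 - delta / 3) * D.
Proof.
move=> /andP[d0 d1] /andP[f0 fL] n0 D0; rewrite ler_pdivrMr// => nD nv.
rewrite -(ler_pM2l n0); apply: (le_trans nv).
have -> : n * ((1 - delta / 3) * D) = (1 - delta / 3) * (n * D) by ring.
apply: (@le_trans _ _ ((1 - delta / 3) * ((1 + delta) * L + f))); last first.
  by apply: ler_wpM2l => //; lra.
have L0 : 0 <= L by lra.
have h1 : 0 <= delta * (L - f) by rewrite mulr_ge0//; lra.
have h2 : 0 <= delta * L * (1 - delta) by rewrite !mulr_ge0//; lra.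
rewrite -subr_ge0; have -> : (1 - delta / 3) * ((1 + delta) * L + f) - (L + f) =
  (delta * (L - f) + delta * L * (1 - delta)) / 3 by field.
by rewrite divr_ge0// addr_ge0.
Qed.

End Thresholds.

(** Low draws cost [O(1 / delta ^ 2)] and everything else beyond the leading term is bounded
    independently of [T]; [C] covers both. *)
Lemma rmed1_regret_le_delta (R : realType) (K : nat) (mu : 'M[R]_K) (w : 'I_K) :
  preference_matrix mu -> condorcet_winner mu w ->
  exists2 C : R, 0 <= C & forall (fK delta : R) (T : nat),
    0 < delta < 1 -> 0 <= fK <= ln T%:R -> (0 < T)%N ->
    rmed1_regret_le mu w fK T
      (\sum_(i | i != w) ((1 + delta) * ln T%:R + fK) * gap mu w i
          / (2 * kl (mu i w) (1 / 2)) + C / delta ^+ 2).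
Proof.
move=> hmu hw; have [mu01 mu_anti mu_half] := hmu.
have [CD [CD0 ECD]] := expect_low_divergence_exceeds (w, w, true) hmu hw.
pose slope i := kl (mu w i) (1 / 2) / ln (mu w i / (1 - mu w i)).
(* At [mu w i = 1] the divergence has no finite tangent, and [expect_visits_certain] takes over. *)
pose v i : R := if mu w i == 1 then 2 else 8 / (slope i / 3) ^+ 2.
pose CB := CD + (2 * K)%:R * (1 + \sum_(s | s != w) 8 / (mu w s - 1 / 2) ^+ 2).
have gap0 i := gap_ge0 i hmu hw.
have CB0 : 0 <= CB.
  apply: addr_ge0 => //; apply: mulr_ge0 => //; apply: addr_ge0 => //.
  by apply: sumr_ge0 => s _; rewrite divr_ge0// sqr_ge0.
have v0 i : 0 <= v i by rewrite /v; case: ifP => // _; rewrite divr_ge0// sqr_ge0.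
pose C := (Tinit K + 2 * K)%:R + CB + \sum_(i | i != w) gap mu w i / 2 *
  ((2 * K)%:R + 1 + (2 * K).+1%:R * (CB + v i)).
have C0 : 0 <= C.
  apply: addr_ge0; first exact: addr_ge0.
  apply: sumr_ge0 => i _; apply: mulr_ge0; first by rewrite divr_ge0.
  by apply: addr_ge0 => //; apply: mulr_ge0 => //; apply: addr_ge0.
exists C => // fK delta T d01 fL T0 d Omega P Z [mZ bZ run].
have [d0 d1] := andP d01; have [f0 _] := andP fL.
pose D i := kl (mu w i) (1 / 2).
have DE i : kl (mu i w) (1 / 2) = D i by rewrite mu_anti kl_half_sym.
have D0 i : i != w -> 0 < D i.
  by move=> iw; rewrite kl_gt0 ?half_in01// ?mu01// gt_eqF// hw.
pose B i := if i == w then 0 else ((1 + delta) * ln T%:R + fK) / D i.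
(* For [mu w i = 1], a single loss among at most [T] draws brings the rate down to [1 - 1 / T];
   otherwise the tangent gives a deficit linear in [delta]. *)
pose y i := if mu w i == 1 then 1 - T%:R^-1 else mu w i - slope i / 3 * delta.
have inner i : i != w -> mu w i != 1 -> 1 / 2 < mu w i < 1.
  move=> iw m1; rewrite hw//= lt_neqAle m1; by case/andP: (mu01 w i).
have L0 : 0 <= ln T%:R :> R by rewrite ln_ge0// ler1n.
have B0 i : 0 <= B i.
  rewrite /B; case: eqVneq => // iw; rewrite divr_ge0 ?(ltW (D0 _ iw))//.
  by rewrite addr_ge0// mulr_ge0//; lra.
have T0R : 0 < T%:R :> R by rewrite ltr0n.
have yB i : i != w -> forall k l, (0 < k + l <= T)%N -> B i <= (k + l)%:R ->
    (k + l)%:R * kl (k%:R / (k + l)%:R) (1 / 2) <= ln T%:R + fK ->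
    k%:R <= y i * (k + l)%:R.
  move=> iw k l /andP[n0 nT]; rewrite {1}/B (negbTE iw); set n := (k + l)%N in n0 nT *.
  move=> nB nkl; have n0R : 0 < n%:R :> R by rewrite ltr0n.
  have klx := kl_threshold d01 fL n0R (D0 i iw) nB nkl.
  have x01 : 0 <= (k%:R / n%:R : R) <= 1.
    rewrite divr_ge0//= ler_pdivrMr// mul1r ler_nat; exact: leq_addr.
  rewrite /y; have [m1|m1] := eqVneq (mu w i) 1; last first.
    rewrite -ler_pdivrMr//; apply: (le_trans (kl_half_tangent_le x01 (inner _ iw m1))).
    rewrite lerD2l lerN2 /slope -/(D i)
      [leLHS](_ : _ = (delta / 3 * D i) / ln (mu w i / (1 - mu w i))); last by ring.
    have /andP[m2 m3] := inner _ iw m1.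
    rewrite ler_pM2r; last first.
      by rewrite invr_gt0 ln_gt0// ltr_pdivlMr ?subr_gt0// mul1r; lra.
    rewrite lerBrDr; apply: le_trans (lerD (lexx _) klx) _.
    by rewrite -mulrDl addrC subrK mul1r.
  (* A record without loss would have divergence [D i], above the threshold. *)
  have lt_kn : (k < n)%N.
    rewrite ltn_neqAle leq_addr andbT; apply/eqP => kn.
    have xE : k%:R / n%:R = mu w i :> R by rewrite m1 kn divff ?gt_eqF.
    move: klx; rewrite xE -/(D i).
    by have := mulr_gt0 d0 (D0 _ iw); lra.
  rewrite mulrBl mul1r; apply: (@le_trans _ _ (n%:R - 1)).
    by rewrite lerBrDr natr1 ler_nat.
  by rewrite lerD2l lerN2 mulrC ler_pdivrMr// mul1r ler_nat.
pose V i := v i / delta ^+ 2.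
have EV i : i != w ->
    @expect R K d Omega P Z T (visits (w, w, true) w i (y i)) <= V i.
  move=> iw; have wi : w != i by rewrite eq_sym.
  rewrite /V /v /y; have [m1|m1] := eqVneq (mu w i) 1.
    apply: (le_trans (expect_visits_certain mZ bZ hmu wi _ m1)).
      by rewrite gtrDl oppr_lt0 invr_gt0.
    by rewrite ler_pdivlMr ?exprn_gt0//; have := exprn_ile1 2 (ltW d0) (ltW d1); lra.
  have m21 := inner _ iw m1; have /andP[m2 m3] := m21.
  have /andP[s0 s2] := kl_half_slope_le m21; rewrite -/(slope i) in s0 s2.
  have sd0 : 0 < slope i / 3 * delta by rewrite mulr_gt0//; lra.
  have sd1 : slope i / 3 * delta <= 1 / 2.
    by apply: (@le_trans _ _ (slope i / 3)); [rewrite ler_piMr//; lra|lra].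
  apply: (le_trans (expect_visits_quadratic mZ bZ hmu wi _)).
    by apply/andP; split; lra.
  have -> : mu w i - (mu w i - slope i / 3 * delta) = slope i / 3 * delta by ring.
  by rewrite exprMn invfM mulrA.
apply: (le_trans (regret_le_expect _ hmu hw mZ
  (fun o => regret_le_history_bound hmu hw f0 (run o) B0 yB))).
rewrite lee_fin; apply: le_trans (expect_history_bound_le hmu hw mZ bZ B (erefl CB) _ EV) _.
  exact: ECD.
have dV : 1 <= (delta ^+ 2)^-1.
  by rewrite invf_ge1 ?exprn_gt0//; apply: exprn_ile1; apply: ltW.
have scale x : 0 <= x -> x <= x / delta ^+ 2 by move=> x0; rewrite ler_peMr.
(* Terms free of [delta] are enlarged by [u], to be [1 / delta ^ 2], so that one constant covers
   them all. *)
have absorb (g b q W c x u : R) : 0 <= g -> 0 <= q -> 0 <= W -> 0 <= c -> 1 <= u ->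
    g * (b + q + 1 + W * (c + x * u)) <= g * b + g * (q + 1 + W * (c + x)) * u.
  move=> g0 q0 W0 c0 u1; rewrite -subr_ge0.
  rewrite (_ : _ - _ = g * ((q + 1 + W * c) * (u - 1))); last by ring.
  by rewrite !mulr_ge0 ?subr_ge0// addr_ge0 ?mulr_ge0// addr_ge0.
have terms : \sum_(i | i != w) gap mu w i / 2 *
      (B i + (2 * K)%:R + 1 + (2 * K).+1%:R * (CB + V i)) <=
    \sum_(i | i != w) ((1 + delta) * ln T%:R + fK) * gap mu w i
        / (2 * kl (mu i w) (1 / 2)) +
    (\sum_(i | i != w) gap mu w i / 2 *
      ((2 * K)%:R + 1 + (2 * K).+1%:R * (CB + v i))) / delta ^+ 2.
  rewrite mulr_suml -big_split /=; apply: ler_sum => i iw.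
  have -> : ((1 + delta) * ln T%:R + fK) * gap mu w i / (2 * kl (mu i w) (1 / 2)) =
      gap mu w i / 2 * B i by rewrite DE /B (negbTE iw) invfM; ring.
  by apply: absorb => //; rewrite divr_ge0.
rewrite /C [X in _ <= _ + X]mulrDl [leRHS]addrCA; apply: lerD terms.
by apply: scale; apply: addr_ge0.
Qed.

(** * Choice of [delta] and large horizons *)

Section PowR.
Context {R : realType}.

Lemma powR_ge1 (x a : R) : 1 <= x -> 0 <= a -> 1 <= x `^ a.
Proof. by move=> x1 a0; rewrite -[leLHS](powRr0 x) ler_powR. Qed.

(* The choice [delta = L ^ (- 1 / 3)] balances [delta * L] and [1 / delta ^ 2]. *)
Lemma balanced_delta (L : R) : 1 < L ->
  let delta := L `^ (- (1 / 3)) in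
  [/\ 0 < delta < 1, delta * L = L `^ (2 / 3) & (delta ^+ 2)^-1 = L `^ (2 / 3)].
Proof.
move=> L1 delta; have L0 : 0 < L by lra.
have Lneq0 : L != 0 by rewrite gt_eqF.
split.
- rewrite /delta powR_gt0//= powRN invf_lt1 ?powR_gt0//.
  rewrite /powR (negbTE Lneq0) -expR0 ltr_expR mulr_gt0 ?ln_gt0//; lra.
- rewrite /delta -[X in _ * X]powRr1 ?ltW// -powRD ?Lneq0 ?implybT//.
  by congr (_ `^ _); lra.
- rewrite /delta powRN exprVn invrK -powR_mulrn ?powR_ge0// -powRrM.
  by congr (_ `^ _); lra.
Qed.

Lemma eventually_ln_ge (x : R) : exists T0 : nat, forall T : nat, (T0 <= T)%N ->
  (0 < T)%N /\ x <= ln T%:R.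
Proof.
exists (Num.bound (expR x)) => T leT.
have : expR x < T%:R.
  apply: lt_le_trans (archi_boundP (expR_ge0 x)) _; by rewrite ler_nat.
move=> lt; have T0 : 0 < T%:R :> R by apply: lt_trans lt; rewrite expR_gt0.
split; first by rewrite -(ltr0n R).
by rewrite -[leLHS]expRK ler_ln ?posrE ?expR_gt0// ltW.
Qed.

End PowR.

Unset Implicit Arguments.

Theorem theorem3 (R : realType) (K : nat) (hK : (0 < K)%N) (mu : 'M[R]_K)
    (hmu : preference_matrix mu) (hw : condorcet_winner mu (arm1 hK)) :
  (exists A : R, forall f : nat -> R, (forall k, 0 <= f k) ->
    exists delta0 : R, 0 < delta0 /\
    exists (C1 C2 C3 : R) (T0 : nat),
    forall (delta : R) (T : nat), 0 < delta < delta0 -> (T0 <= T)%N ->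
      rmed1_regret_le mu (arm1 hK) (f K) T
        (\sum_(i < K | i != arm1 hK)
            ((1 + delta) * ln T%:R + f K) * gap mu (arm1 hK) i
            / (2 * kl (mu i (arm1 hK)) (1 / 2))
         + C1 * K%:R ^+ 2
         + C2 * (K%:R / delta ^+ 2)
         + C3 * (K%:R * expR (A * K%:R - f K))))
  /\
  (forall c eps : R, 0 < c -> 0 < eps ->
    exists (C1 C2 : R) (T0 : nat),
    forall T : nat, (T0 <= T)%N ->
      rmed1_regret_le mu (arm1 hK) (c * (K%:R `^ (1 + eps))) T
        (\sum_(i < K | i != arm1 hK)
            gap mu (arm1 hK) i * ln T%:R
            / (2 * kl (mu i (arm1 hK)) (1 / 2))
         + C1 * (K%:R `^ (2 + eps))
         + C2 * (K%:R * (ln T%:R `^ (2 / 3))))).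
Proof.
have [C C0 regretP] := rmed1_regret_le_delta hmu hw.
have mono fK T b b' : b <= b' -> rmed1_regret_le mu (arm1 hK) fK T b ->
    rmed1_regret_le mu (arm1 hK) fK T b'.
  move=> bb' H d Omega P Z run; apply: le_trans (H d Omega P Z run) _.
  by rewrite lee_fin.
have K1 : 1 <= K%:R :> R by rewrite ler1n.
have K0 : 0 <= K%:R :> R by [].
split.
  (* The implied constants may depend on [K] and [mu], so that [C / delta ^ 2]
     absorbs the other two error terms. *)
  exists 0 => f f0; exists 1; split=> //.
  have [T0 T0P] := eventually_ln_ge (f K).
  exists 0, C, 0, T0 => delta T d01 /T0P[T_gt0 fL].
  apply: mono (regretP (f K) delta T d01 _ T_gt0); last by rewrite f0.
  rewrite !mul0r !addr0 lerD2l [K%:R / _]mulrC mulrA ler_peMr//.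
  by rewrite mulr_ge0// invr_ge0 sqr_ge0.
move=> c eps c0 eps0; set f := c * _.
have f0 : 0 <= f by rewrite mulr_ge0 ?powR_ge0// ltW.
pose G : R := \sum_(i < K | i != arm1 hK)
  gap mu (arm1 hK) i / (2 * kl (mu i (arm1 hK)) (1 / 2)).
have G0 : 0 <= G.
  have [mu01 _ _] := hmu; apply: sumr_ge0 => i iw.
  by rewrite divr_ge0 ?mulr_ge0 ?kl_ge0 ?half_in01// gap_ge0.
(* This ensures both [ln T > 1], as [balanced_delta] requires, and [f <= ln T]. *)
have [T0 T0P] := eventually_ln_ge (2 + f).
(* [f * G] is the share of [f] in the leading sum; [G] and [C] go with [delta * ln T] and
   [1 / delta ^ 2], both equal to [ln T] to the power [2 / 3]. *)
exists (f * G), (G + C), T0 => T /T0P[T_gt0 fL].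
have [|d01 dL d2] := @balanced_delta R (ln T%:R); first by lra.
set delta := _ `^ - _ in d01 dL d2; set L := ln T%:R in fL dL d2 *.
apply: mono (regretP f delta T d01 _ T_gt0); last by rewrite f0 (le_trans _ fL)// lerDr.
have -> : \sum_(i < K | i != arm1 hK) ((1 + delta) * L + f) * gap mu (arm1 hK) i /
      (2 * kl (mu i (arm1 hK)) (1 / 2)) =
    \sum_(i < K | i != arm1 hK) gap mu (arm1 hK) i * L / (2 * kl (mu i (arm1 hK)) (1 / 2))
    + (f * G + L `^ (2 / 3) * G).
  rewrite -mulrDl /G mulr_sumr -big_split /=; apply: eq_bigr => i _.
  by rewrite -dL; ring.
rewrite d2 -!addrA lerD2l; apply: lerD.
  by apply: ler_peMr; [exact: mulr_ge0|apply: powR_ge1 => //; lra].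
rewrite [_ * G]mulrC -mulrDl; apply: ler_wpM2l; first exact: addr_ge0.
by rewrite ler_peMl// powR_ge0.
Qed.
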